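(* For every $n\ge 2$ the genus distribution of ${\cal S}_5^n$ is unimodal, and its peak $p_5(n)$ is $$p_5(n)=\begin{cases}\Big[\dfrac{n}{2}\Big], & 2\le n\le 5,\\[2mm] \Big[\dfrac{n+1}{3}\Big]+1, & 6\le n\le 16,\\[2mm] \Big[\dfrac{n+2}{3}\Big]+1, & n\ge 17.\end{cases}$$
   Context: $[x]$ denotes the largest integer not exceeding $x$. A surface is represented by a cyclic word in which every occurring letter $x$ appears exactly once as $x$ and exactly once as $x^-$; it is the closed orientable surface obtained from a polygon with boundary labelled by the word by identifying each side $x$ with the side $x^-$ (orientation reversed), and its genus is the genus of that surface. Let $a,a_1,a_2,\dots$ be distinct letters. For $n\ge 1$ and subsets $K,T\subseteq\{1,\dots,n\}$ put: $R_1^n$ = product of the letters $a_k$, $k\in K$, in decreasing order of index; $R_2^n$ = product of the $a_k$, $k\notin K$, in increasing order of index; $R_3^n$ = product of the $a_t^-$, $t\in T$, in decreasing order of index; $R_4^n$ = product of the $a_t^-$, $t\notin T$, in increasing order of index. The set of ladder surfaces considered is ${\cal S}_5^n=\{aR_1^nR_3^na^-R_2^nR_4^n\}$, where $(K,T)$ runs over all $4^n$ pairs of subsets and surfaces are counted with multiplicity (one for each pair). $g_{i_5}(n)$ is the number of surfaces of genus $i$ in ${\cal S}_5^n$, and the genus distribution of ${\cal S}_5^n$ is the sequence $(g_{i_5}(n))_i$, with $i$ running from the minimum to the maximum genus of surfaces in ${\cal S}_5^n$. A finite sequence of nonnegative numbers $\{a_i\}_{i=q}^n$ is unimodal if $a_q\le\cdots\le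 a_{l-1}<a_l=\cdots=a_m>a_{m+1}\ge\cdots\ge a_n$ for some $q\le l\le m\le n$; $l,\dots,m$ are its modes, and if $l=m$ then $m$ is called the peak (indices are genera). *)

(* Defs.v *)
From mathcomp Require Import all_boot all_order all_algebra.

Set Implicit Arguments.
Unset Strict Implicit.
Unset Printing Implicit Defensive.

Section PolygonalSurface.

Variable L : eqType.

(* A letter [x] is encoded as [(x, true)] and [x^-] as [(x, false)].  Words are
   read cyclically. *)
Definition sletter := (L * bool)%type.

Definition pos (x : L) : sletter := (x, true).
Definition neg (x : L) : sletter := (x, false).

(* Every occurring letter occurs exactly once as [x] and once as [x^-]. *)
Definition surface_word (w : seq sletter) : Prop :=
  forall x, x \in unzip1 w ->
    count_mem (pos x) w = 1 /\ count_mem (neg x) w = 1.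

Variable w : seq sletter.

(* Sides and corners of the polygon are both indexed by ['I_(size w)]: side [i]
   runs from corner [i] to corner [ordS i]. *)
Definition side (i : 'I_(size w)) : sletter := tnth (in_tuple w) i.

Definition glued (i j : 'I_(size w)) : bool :=
  ((side i).1 == (side j).1) && ((side i).2 != (side j).2).

(* Gluing reverses orientation: the initial corner of a side is identified with
   the terminal corner of its mate. *)
Definition corner_glued : rel 'I_(size w) := fun c d =>
  [exists i, exists j, glued i j &&
     ((c == i) && (d == ordS j) || (c == ordS i) && (d == j))].

Lemma corner_glued_sym : symmetric corner_glued.
Proof.
have half c d : corner_glued c d -> corner_glued d c.
  case/existsP=> i /existsP[j /andP[/andP[e1 e2] h]].
  apply/existsP; exists j; apply/existsP; exists i.
  rewrite /glued eq_sym e1 eq_sym e2 /=.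
  by case/orP: h => /andP[-> ->]; rewrite ?orbT.
by move=> c d; apply/idP/idP; apply: half.
Qed.

Definition nb_vertices : nat := n_comp corner_glued predT.
Definition nb_edges : nat := (size w)./2.

Definition euler_char : int := (nb_vertices%:Z - nb_edges%:Z + 1)%R.

(* The genus [g] is given by [euler_char = 2 - 2 g]; a surface word yields a
   closed connected orientable surface, so that [2 - euler_char] is
   nonnegative and even. *)
Definition genus : nat := `|(2 - euler_char)%R|%N./2.

End PolygonalSurface.

Section LadderSurfaces.

Variable n : nat.

(* [None] is the letter [a]; [Some k] is [a_(k+1)], indices starting at 0.
   [enum] of a set of ordinals is increasing. *)
Definition letter := option 'I_n.

Definition R1 (K : {set 'I_n}) : seq (sletter letter) :=
  [seq pos (Some k) | k <- rev (enum K)].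
Definition R2 (K : {set 'I_n}) : seq (sletter letter) :=
  [seq pos (Some k) | k <- enum (~: K)].
Definition R3 (T : {set 'I_n}) : seq (sletter letter) :=
  [seq neg (Some t) | t <- rev (enum T)].
Definition R4 (T : {set 'I_n}) : seq (sletter letter) :=
  [seq neg (Some t) | t <- enum (~: T)].

Definition ladder5 (KT : {set 'I_n} * {set 'I_n}) : seq (sletter letter) :=
  pos None :: R1 KT.1 ++ R3 KT.2 ++ neg None :: R2 KT.1 ++ R4 KT.2.

Lemma ladder5_surface_word KT : surface_word (ladder5 KT).
Proof.
have cm (b c : bool) (s : seq 'I_n) x :
    count_mem ((Some x, b) : sletter letter) [seq (Some k, c) | k <- s]
    = (b == c) * count_mem x s.
  elim: s => [|y s IHs] /=; first by rewrite muln0.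
  rewrite IHs mulnDr; congr (_ + _).
  by rewrite xpair_eqE (inj_eq Some_inj) eq_sym eq_sym andbC mulnb (eq_sym c).
have cn (b c : bool) (s : seq 'I_n) :
    count_mem ((None, b) : sletter letter) [seq (Some k, c) | k <- s] = 0.
  by elim: s => [|y s IHs] //=.
have ce (A : {set 'I_n}) x : count_mem x (enum A) = (x \in A).
  by rewrite count_uniq_mem ?enum_uniq ?mem_enum.
have cr (A : {set 'I_n}) x : count_mem x (rev (enum A)) = (x \in A).
  by rewrite count_rev ce.
case: KT => K T x _; rewrite /ladder5 /R1 /R2 /R3 /R4 /pos /neg /=.
rewrite !count_cat /= !count_cat.
case: x => [x|]; last by rewrite !cn.
rewrite !cm !cr !ce !inE /= !mul1n !mul0n.
by case: (x \in K); case: (x \in T).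
Qed.

Definition genus5 (KT : {set 'I_n} * {set 'I_n}) : nat := genus (ladder5 KT).

Definition g5 (i : nat) : nat := #|[set KT | genus5 KT == i]|.

Definition min_genus5 : nat :=
  genus5 [arg min_(KT < (set0, set0)) genus5 KT].
Definition max_genus5 : nat :=
  genus5 [arg max_(KT > (set0, set0)) genus5 KT].

End LadderSurfaces.

(* The finite sequence is [a_q, ..., a_r]; the strict inequalities at [l] and
   [m] are vacuous when [l = q], respectively [m = r]. *)
Definition has_modes (a : nat -> nat) (q r l m : nat) : Prop :=
  [/\ q <= l <= m /\ m <= r,
      (forall i, q <= i -> i.+1 < l -> a i <= a i.+1) /\
        (q < l -> a l.-1 < a l),
      forall i, l <= i <= m -> a i = a l
    & (m < r -> a m.+1 < a m) /\
        (forall i, m < i -> i < r -> a i.+1 <= a i)].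

Definition unimodal (a : nat -> nat) (q r : nat) : Prop :=
  exists l m, has_modes a q r l m.

Definition is_peak (a : nat -> nat) (q r p : nat) : Prop :=
  has_modes a q r p p.

Definition p5 (n : nat) : nat :=
  if n <= 5 then n %/ 2
  else if n <= 16 then (n + 1) %/ 3 + 1
  else (n + 2) %/ 3 + 1.

(* Main.v *)
From Stdlib Require Import ZArith.
Require Import Defs.
From mathcomp Require Import all_boot all_order all_algebra.
From mathcomp Require Import all_fingroup zify ring.

(** The vertices of a polygonal surface are the cycles of the permutation
    "mate, then next side".  The two ends of the letter of largest index are
    always inserted next to one of four fixed corners of the ladder word, so we
    put markers at these corners: a new letter either splits off a vertex or
    exchanges the successors of two markers.  The genus is therefore computed by
    a finite automaton whose states are the permutations of the markers; merging
    equivalent states leaves 13 classes.  Solving the resulting linear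
    recurrences for the generating polynomials gives, with
    [1 - 2 z - 8 x z^2], [1 - z - 8 x z^2] and [1 - 4 x z^2] as denominators and
    [L n j] the number of [j]-matchings of the cycle of length [n],
      [g (j + 1) = 2^(n+j) L n j + 8^(j+1) L n (j+1) - 8^j L n j + small terms].
    The ratio of consecutive values of [2^j L n j] is at least [1] exactly when
    [(3 j + 1 - n) (3 j + 1 - 2 n) >= 0], which locates the peak near [n / 3]; for
    [n = 3 j + 1] the two leading terms agree and the terms in [8^j] decide,
    which is why the formula for the peak changes at [n = 17]. *)

Set Implicit Arguments.
Unset Strict Implicit.
Unset Printing Implicit Defensive.

(** * Cycles of permutations *)

Section Cycles.

Variable T : finType.
Implicit Types (s t : {perm T}) (x y a b : T).

Definition ncycles s := #|porbits s|.

Lemma porbitE s x y : (y \in porbit s x) = fconnect s x y.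
Proof.
apply/porbitP/idP => [[i ->]|/iter_findex <-].
  by rewrite permX; apply: fconnect_iter.
by exists (findex s x y); rewrite permX.
Qed.

Lemma ncycles_fcard s : ncycles s = fcard s predT.
Proof.
rewrite /ncycles /n_comp_mem.
have -> : porbits s = porbit s @: froots s.
  apply/setP => A; apply/imsetP/imsetP => -[x _ ->]; last by exists x.
  exists (froot s x); first exact: (roots_root (fconnect_sym perm_inj)).
  by apply/eqP; rewrite eq_porbit_mem porbit_sym porbitE connect_root.
rewrite card_in_imset => [|x y /eqP rx /eqP ry /eqP].
  by apply: eq_card => x; rewrite !inE andbT.
rewrite eq_porbit_mem porbitE => /(fingraph.rootP (fconnect_sym perm_inj)) e.
by rewrite -rx -ry e.
Qed.

Lemma ncyclesJ s t : ncycles (s ^ t)%g = ncycles s.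
Proof.
have pJ x : porbit (s ^ t)%g (t x) = [set t y | y in porbit s x].
  apply/setP => z; rewrite -[z](permKV t) (mem_imset _ _ perm_inj).
  apply/porbitP/porbitP => -[i e]; exists i.
    by apply: (@perm_inj _ t); rewrite e -conjXg permJ.
  by rewrite e -conjXg permJ.
rewrite /ncycles.
have -> : porbits (s ^ t)%g = (fun A : {set T} => [set t y | y in A]) @: porbits s.
  apply/setP => A; apply/imsetP/imsetP => [[x _ ->]|[_ /imsetP[x _ ->] ->]].
    exists (porbit s ((t^-1)%g x)); first exact: imset_f.
    by rewrite -pJ permKV.
  by exists (t x).
by rewrite card_imset //; apply: imset_inj; apply: perm_inj.
Qed.

Lemma ncyclesC s t : ncycles (s * t)%g = ncycles (t * s)%g.
Proof. by rewrite -(ncyclesJ _ s); congr ncycles; rewrite conjgE !mulgA mulVg mul1g. Qed.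

Lemma porbit_closed s (A : {pred T}) x y :
  y \in porbit s x -> x \in A -> {in A, forall z, s z \in A} -> y \in A.
Proof.
move=> /porbitP[i ->] Ax As.
by elim: i => [|i IHi]; rewrite ?perm1 // expgSr permM As.
Qed.

(** The two elements lie in distinct cycles, which the transposition merges. *)
Lemma ncycles_tperm s a b :
  a \notin porbit s b -> ncycles (tperm a b * s)%g + 1 = ncycles s.
Proof.
move=> nab; have := porbits_mul_tperm s a b; rewrite /= nab.
have [ab|_] := eqVneq a b; first by rewrite ab porbit_id in nab.
by rewrite -/(ncycles _) -/(ncycles s) /=; lia.
Qed.

Lemma ncycles_tperm_fix s a b :
  a != b -> s b = b -> ncycles (tperm a b * s)%g + 1 = ncycles s.
Proof.
move=> nab sb; apply: ncycles_tperm; apply: contra nab => h.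
apply: (@porbit_closed _ (pred1 b) _ _ h); first exact: eqxx.
by move=> y /eqP->; rewrite inE sb.
Qed.

Lemma ncycles_tperm_swap1 s a x y :
  s x = y -> s y = x -> a \notin [:: x; y] ->
  ncycles (tperm a y * s)%g + 1 = ncycles s.
Proof.
move=> sx sy; rewrite !inE => naxy; apply: ncycles_tperm.
apply: contra naxy => h; apply: (@porbit_closed _ (pred2 x y) _ _ h).
  by rewrite inE /= eqxx orbT.
by move=> z /orP[]/eqP->; rewrite inE /= ?sx ?sy eqxx ?orbT.
Qed.

(* Inserting the two ends of a band [x, y] in the cycles at [a] and [b]
   amounts, up to the length of the cycles, to exchanging the successors of [a]
   and [b]. *)
Lemma ncycles_insert s a b x y :
    s x = y -> s y = x -> x != y -> a != b ->
    a \notin [:: x; y] -> b \notin [:: x; y] ->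
  ncycles (tperm a y * tperm b x * s)%g + 1 = ncycles (tperm a b * s)%g.
Proof.
move=> sx sy nxy nab; rewrite !inE !negb_or => /andP[nax nay] /andP[nbx nby].
(* In [s0] both [x] and [y] are fixed points. From [tperm a b * s0], the left side arises by two
   merges and the right side by one. *)
pose s0 := (tperm x y * s)%g.
have s0x : s0 x = x by rewrite permM tpermL sy.
have s0y : s0 y = y by rewrite permM tpermR sx.
have -> : (tperm a y * tperm b x * s = tperm a x * (tperm b y * (tperm a b * s0)))%g.
  rewrite /s0 !mulgA; congr (_ * _)%g; apply/permP => z.
  have E := (negPf nxy, negPf nab, negPf nax, negPf nay, negPf nbx, negPf nby,
    eq_sym y x, eq_sym b a, eq_sym x a, eq_sym y a, eq_sym x b, eq_sym y b).
  rewrite !permM !permE /=.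
  have [za|za] := eqVneq z a; first by rewrite ?za !(E, eqxx).
  have [zb|zb] := eqVneq z b; first by rewrite ?zb !(E, eqxx).
  have [zx|zx] := eqVneq z x; first by rewrite ?zx !(E, eqxx).
  have [zy|zy] := eqVneq z y; first by rewrite ?zy !(E, eqxx).
  by rewrite !(negPf za, negPf zb, negPf zx, negPf zy).
have tabs0 z : z \in [:: x; y] -> (tperm a b * s0)%g z = z.
  by rewrite !inE => /orP[]/eqP->; rewrite permM tpermD.
have -> : (tperm a b * s = tperm y x * (tperm a b * s0))%g.
  have tC : (tperm a b * tperm x y = tperm x y * tperm a b)%g.
    by rewrite conjgC tpermJ /aperm !tpermD // 1?eq_sym.
  by rewrite /s0 (tpermC y) !mulgA -tC -(mulgA (tperm a b)) tperm2 mulg1.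
have e1 : ncycles (tperm b y * (tperm a b * s0))%g + 1 = ncycles (tperm a b * s0)%g.
  by apply: ncycles_tperm_fix; rewrite ?tabs0 ?inE ?eqxx ?orbT.
have e2 : ncycles (tperm y x * (tperm a b * s0))%g + 1 = ncycles (tperm a b * s0)%g.
  by apply: ncycles_tperm_fix; rewrite ?tabs0 ?inE ?eqxx // 1?eq_sym.
rewrite ncycles_tperm_fix //; first lia.
by rewrite permM tpermD ?tabs0 ?inE ?eqxx // 1?eq_sym.
Qed.

End Cycles.

(** * Inserting a letter at two corners *)

Section Band.

Variable T : finType.
Implicit Types (s t : {perm T}) (x y a b : T).

Lemma mul_tperm s a b :
  (s * tperm a b = tperm ((s^-1)%g a) ((s^-1)%g b) * s)%g.
Proof. by rewrite -tpermJ conjgE invgK !mulgA mulgKV. Qed.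

(** If [a] and [b] differ, the product equals [tperm b y * (tperm a b * s)], where the cycle of [x]
    and [y] is still intact and gets merged with that of [b]. If they are equal, the transpositions
    cancel. *)
Lemma ncycles_insert1 s a b x y :
    s x = y -> s y = x -> a \notin [:: x; y] -> b \notin [:: x; y] ->
  ncycles (tperm a y * tperm b y * s)%g + (a != b)
    = ncycles (tperm a b * s)%g.
Proof.
move=> sx sy; rewrite !inE !negb_or => /andP[nax nay] /andP[nbx nby].
have [->|nab] := eqVneq a b; first by rewrite tperm2 tperm1 addn0.
have -> : (tperm a y * tperm b y * s = tperm b y * (tperm a b * s))%g.
  by rewrite (conjgC (tperm a y)) tpermJ /aperm tpermR mulgA tpermD // eq_sym.
apply: (@ncycles_tperm_swap1 _ _ b x y).
- by rewrite permM tpermD.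
- by rewrite permM tpermD.
- by rewrite !inE negb_or nbx nby.
Qed.

(* The corner at which the side [x], respectively [y], is inserted: after [m0]
   or before [m1], respectively after [m2] or before [m3]. *)
Lemma ncycles_band t (mu nu : {perm T}) m0 m1 m2 m3 x y (bK bT : bool) :
    uniq [:: m0; m1; m2; m3; x; y] ->
    t x = x -> t y = y -> mu x = y -> mu y = x -> nu x = x -> nu y = y ->
    mu m0 = m0 -> mu m2 = m2 ->
  let nu1 := (if bK then tperm m0 x * nu else nu * tperm m1 x)%g in
  let nu2 := (if bT then tperm m2 y * nu1 else nu1 * tperm m3 y)%g in
  let p := if bK then (t^-1)%g m0 else m1 in
  let q := if bT then (t^-1)%g m2 else m3 in
  ncycles (t * mu * nu2)%g + (p != q)
    = ncycles (tperm p q * (t * mu * nu))%g.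
Proof.
move=> U tx ty mux muy nux nuy mu0 mu2 nu1 nu2 p q.
pose psi := (t * mu * nu)%g.
have psx : psi x = y by rewrite !permM tx mux nuy.
have psy : psi y = x by rewrite !permM ty muy nux.
have nxy : x != y.
  by have := subseq_uniq (suffix_subseq [:: m0; m1; m2; m3] [:: x; y]) U;
    rewrite /= inE andbT.
have mxy m : m \in [:: m0; m1; m2; m3] -> m \notin [:: x; y].
  move=> h; apply/negP => h2; move: U; rewrite (cat_uniq [:: _; _; _; _]).
  by case/and3P=> _ /hasPn/(_ _ h2)/negP.
have tV m : m \notin [:: x; y] -> (t^-1)%g m \notin [:: x; y].
  apply: contra; rewrite !inE => /orP[]/eqP e.
    by rewrite -(permKV t m) e tx eqxx.
  by rewrite -(permKV t m) e ty eqxx orbT.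
have txV : (t^-1)%g x = x by rewrite -{1}tx permK.
have tyV : (t^-1)%g y = y by rewrite -{1}ty permK.
have mxV : (mu^-1)%g x = y by rewrite -muy permK.
have myV : (mu^-1)%g y = x by rewrite -mux permK.
have m0V : (mu^-1)%g m0 = m0 by rewrite -{1}mu0 permK.
have m2V : (mu^-1)%g m2 = m2 by rewrite -{1}mu2 permK.
(* An insertion after a corner, carried to the left across [t * mu], acts at the preimage of the
   corner and on the mate of the inserted letter. *)
have e0 r : (t * mu * (tperm m0 x * r) = tperm ((t^-1)%g m0) y * (t * mu * r))%g.
  by rewrite mulgA mul_tperm invMg !permM m0V mxV tyV -mulgA.
have e2 r : (t * mu * (tperm m2 y * r) = tperm ((t^-1)%g m2) x * (t * mu * r))%g.
  by rewrite mulgA mul_tperm invMg !permM m2V myV txV -mulgA.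
have np : p \notin [:: x; y] by rewrite /p; case: (bK); rewrite ?tV ?mxy ?inE ?eqxx ?orbT.
have nq : q \notin [:: x; y] by rewrite /q; case: (bT); rewrite ?tV ?mxy ?inE ?eqxx ?orbT.
have pq : bK = bT -> p != q.
  rewrite /p /q => <-; case: (bK); rewrite ?(inj_eq perm_inj).
    by move: U; rewrite /= !inE !negb_or -!andbA; do !case/andP=> ? //.
  by move: U; rewrite /= !inE !negb_or -!andbA; do !case/andP=> ? //.
have np' : p \notin [:: y; x] by move: np; rewrite !inE orbC.
have nq' : q \notin [:: y; x] by move: nq; rewrite !inE orbC.
have nyx : y != x by rewrite eq_sym.
have qp (e : bK = bT) : q != p by rewrite eq_sym (pq e).
rewrite -/psi; move: pq qp np nq np' nq'; rewrite {}/nu2 {}/nu1 {}/p {}/q.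
(* Insertions on the same side reduce to [ncycles_insert]. In the mixed cases a cyclic rotation
   brings both transpositions to the front, where they share a letter. *)
case: bK; case: bT => pq qp np nq np' nq'.
- rewrite e2 e0 -/psi pq // mulgA (tpermC _ ((t^-1)%g m2)).
  by apply: ncycles_insert => //; rewrite qp.
- rewrite [(t * mu * _)%g]mulgA e0 -/psi [in LHS]ncyclesC mulgA.
  by rewrite eq_sym (tpermC _ m3); apply: (@ncycles_insert1 _ _ _ x y).
- have -> : (t * mu * (tperm m2 y * (nu * tperm m1 x))
      = tperm ((t^-1)%g m2) x * psi * tperm m1 x)%g by rewrite e2 /psi !mulgA.
  by rewrite ncyclesC mulgA; apply: (@ncycles_insert1 _ _ _ y x).
- have -> : (t * mu * (nu * tperm m1 x * tperm m3 y)
      = psi * (tperm m1 x * tperm m3 y))%g by rewrite /psi !mulgA.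
  have := np; have := nq; rewrite !inE !negb_or => /andP[n3x n3y] /andP[n1x n1y].
  rewrite ncyclesC pq // (tpermC m1 m3) (conjgC (tperm m1 x)) tpermJ /aperm.
  rewrite !tpermD //; first by apply: ncycles_insert; rewrite ?qp.
  - by rewrite qp.
  - by rewrite eq_sym.
Qed.

End Band.

(** * Cyclic words as permutations *)

Section Next.

Variable T : finType.
Implicit Types (s t : {perm T}) (x y z a b : T) (w : seq T).

Lemma next_notin w z : z \notin w -> next w z = z.
Proof. by rewrite next_nth => /negPf->. Qed.

Lemma next_at_notin z y0 y w : z != y -> z \notin w -> next_at z y0 y w = z.
Proof.
elim: w y => [|y' w IHw] y /= /negPf zy; first by rewrite zy.
by rewrite inE negb_or zy => /andP[]; apply: IHw.
Qed.

Lemma next_insert_after w1 w2 m x z : uniq (w1 ++ m :: x :: w2) ->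
  next (w1 ++ m :: x :: w2) z = next (w1 ++ m :: w2) (tperm m x z).
Proof.
move=> U; have U' : uniq (w1 ++ m :: w2).
  apply: subseq_uniq U; apply: cat_subseq => //=.
  by rewrite eqxx; apply: subseq_cons.
rewrite -(next_rot (size w1) U) -(next_rot (size w1) U') !rot_size_cat /=.
have /and3P[] : [&& m != x, m \notin w2 ++ w1 & x \notin w2 ++ w1].
  move: U; rewrite cat_uniq /= !(inE, mem_cat, negb_or) -!andbA.
  by case/and5P=> _ -> -> _ /and4P[-> -> -> _].
move: (w2 ++ w1) => w nmx mw xw.
case: tpermP => [->|->|/eqP/negPf zm /eqP/negPf zx].
- by rewrite eqxx next_at_notin // eq_sym.
- case: w mw xw => [|y w] //=; rewrite ?eqxx 1?eq_sym (negPf nmx) ?eqxx //=.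
- rewrite zm; case: w mw xw => [|y w] _ _ /=; by rewrite zm zx.
Qed.

Lemma next_insert_before w1 w2 m x z : uniq (w1 ++ x :: m :: w2) ->
  next (w1 ++ x :: m :: w2) z = tperm m x (next (w1 ++ m :: w2) z).
Proof.
move=> U; have U' : uniq (w1 ++ m :: w2).
  by apply: subseq_uniq U; apply: cat_subseq (subseq_refl _) (subseq_cons _ _).
rewrite -(next_rot (size w1) U) -(next_rot (size w1) U') !rot_size_cat /=.
have /and3P[] : [&& m != x, m \notin w2 ++ w1 & x \notin w2 ++ w1].
  move: U; rewrite cat_uniq /= !(inE, mem_cat, negb_or) (eq_sym x) -!andbA.
  by case/and5P=> _ -> -> _ /and4P[-> -> -> _].
move: (w2 ++ w1) => w nmx.
have [->|zx] := eqVneq z x.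
  by move=> mw xw; rewrite next_at_notin ?tpermR // eq_sym.
have [->|zm] := eqVneq z m.
  case: w => [|y w] /=; rewrite eqxx ?tpermL // !inE !negb_or.
  by move=> /andP[my _] /andP[xy _]; rewrite tpermD.
(* The running position of both [next_at] is generalised for the induction; their closing values [x]
   and [m] are kept. *)
move: {2 5}m => y mw xw.
elim: w y mw xw => [|y' w IHw] y /=.
  by case: eqP => _ _ _; rewrite ?tpermL // tpermD // 1?eq_sym.
rewrite !inE !negb_or => /andP[my' mw] /andP[xy' xw].
by case: eqP => _; [rewrite tpermD | apply: IHw].
Qed.

(** [next w] is injective when [w] has no repetition; the identity is the default when it is not
    injective. *)
Definition cycperm w : {perm T} := insubd (1%g : {perm T}) [ffun z => next w z].

Lemma cycpermE w z : uniq w -> cycperm w z = next w z.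
Proof.
move=> U; rewrite -pvalE /cycperm -[pval _]/(val _) insubdK ?ffunE //.
by apply/injectiveP => a b; rewrite !ffunE; apply: (can_inj (prev_next U)).
Qed.

Lemma cycperm_after w1 w2 m x : uniq (w1 ++ m :: x :: w2) ->
  cycperm (w1 ++ m :: x :: w2) = (tperm m x * cycperm (w1 ++ m :: w2))%g.
Proof.
move=> U; have U' : uniq (w1 ++ m :: w2).
  apply: subseq_uniq U; apply: cat_subseq => //=.
  by rewrite eqxx; apply: subseq_cons.
by apply/permP => z; rewrite permM !cycpermE // next_insert_after.
Qed.

Lemma cycperm_before w1 w2 m x : uniq (w1 ++ x :: m :: w2) ->
  cycperm (w1 ++ x :: m :: w2) = (cycperm (w1 ++ m :: w2) * tperm m x)%g.
Proof.
move=> U; have U' : uniq (w1 ++ m :: w2).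
  by apply: subseq_uniq U; apply: cat_subseq (subseq_refl _) (subseq_cons _ _).
by apply/permP => z; rewrite permM !cycpermE // next_insert_before.
Qed.

Lemma cycperm_notin w z : uniq w -> z \notin w -> cycperm w z = z.
Proof. by move=> U zw; rewrite cycpermE // next_notin. Qed.

End Next.

(** * Ladder words with markers *)

Section MarkedWord.

Variable n : nat.

Definition token := ((option 'I_n * bool) + 'I_4)%type.

Definition letter_pos k : token := inl (Some k, true).
Definition letter_neg k : token := inl (Some k, false).
Definition marker (i : nat) : token := inr (inord i).

Variables K J : {set 'I_n}.
Implicit Types s t : seq 'I_n.

(* [marker 0] stands right after [a], [marker 1] between [R2] and [R4],
   [marker 2] between [R1] and [R3], and [marker 3] right before [a].  The
   letters placed so far are separate for their two signs, so that the two ends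
   of a letter can be inserted one at a time. *)
Definition marked s t : seq token :=
  inl (None, true) :: marker 0 :: map letter_pos (rev [seq k <- s | k \in K])
  ++ marker 2 :: map letter_neg (rev [seq k <- t | k \in J])
  ++ inl (None, false) :: map letter_pos [seq k <- s | k \notin K]
  ++ marker 1 :: map letter_neg [seq k <- t | k \notin J] ++ [:: marker 3].

(** Membership and absence of repetition are read off the right-hand side, where [K] and [J] have
    disappeared. *)
Lemma perm_marked s t : perm_eq (marked s t)
  ([:: inl (None, true); inl (None, false)] ++ [seq marker i | i <- iota 0 4]
   ++ map letter_pos s ++ map letter_neg t).
Proof.
have cf (A : {set 'I_n}) q (r : seq 'I_n) :
    count q [seq k <- r | k \in A] + count q [seq k <- r | k \notin A] = count q r.
  by rewrite -count_cat; apply/(@seq.permP _ _ r)/permPl/perm_filterC.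
apply/seq.permP => p; rewrite /marked /= !count_cat /= !count_cat /= !count_cat /=.
rewrite !(count_cat, count_map, count_rev) -(cf K _ s) -(cf J _ t) /=; lia.
Qed.

Lemma mem_marked_pos s t k : (letter_pos k \in marked s t) = (k \in s).
Proof.
rewrite (perm_mem (perm_marked s t)) !(inE, mem_cat) /=.
rewrite (mem_map (f := letter_pos)); last by move=> ? ? [].
by rewrite orbC; case: mapP => // -[].
Qed.

Lemma mem_marked_neg s t k : (letter_neg k \in marked s t) = (k \in t).
Proof.
rewrite (perm_mem (perm_marked s t)) !(inE, mem_cat) /=.
rewrite (mem_map (f := letter_neg)); last by move=> ? ? [].
by case: mapP => // -[].
Qed.

Lemma marker_eq i j : i < 4 -> j < 4 -> (marker i == marker j) = (i == j).
Proof.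
move=> hi hj; apply/eqP/eqP => [[]|-> //].
by move/(congr1 (@nat_of_ord 4)); rewrite !inordK.
Qed.

Lemma marked_uniq s t : uniq s -> uniq t -> uniq (marked s t).
Proof.
move=> Us Ut; rewrite (perm_uniq (perm_marked s t)) !cat_uniq.
have -> : uniq (map letter_pos s) by rewrite map_inj_uniq // => ? ? [].
have -> : uniq (map letter_neg t) by rewrite map_inj_uniq // => ? ? [].
have -> : uniq [seq marker i | i <- iota 0 4].
  rewrite map_inj_in_uniq // => i j; rewrite !mem_iota => hi hj /eqP.
  by rewrite marker_eq // => /eqP.
have -> : has (mem (map letter_pos s)) (map letter_neg t) = false.
  by apply/hasP => -[_ /mapP[? _ ->] /mapP[]].
rewrite !has_cat.
have -> : has (mem [:: inl (None, true); inl (None, false)]) (map letter_pos s) = false.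
  by apply/hasP => -[_ /mapP[? _ ->]].
have -> : has (mem [:: inl (None, true); inl (None, false)]) (map letter_neg t) = false.
  by apply/hasP => -[_ /mapP[? _ ->]].
have -> : has (mem [seq marker i | i <- iota 0 4]) (map letter_pos s) = false.
  by apply/hasP => -[_ /mapP[? _ ->] /mapP[]].
have -> : has (mem [seq marker i | i <- iota 0 4]) (map letter_neg t) = false.
  by apply/hasP => -[_ /mapP[? _ ->] /mapP[]].
by [].
Qed.

(** [R1] is decreasing and [R2] increasing, so the last letter lands right after [marker 0] or right
    before [marker 1], whatever the other letters are. *)
Lemma cycperm_marked_x s t k : uniq (rcons s k) -> uniq t ->
  cycperm (marked (rcons s k) t) =
    (if k \in K then tperm (marker 0) (letter_pos k) * cycperm (marked s t)
     else cycperm (marked s t) * tperm (marker 1) (letter_pos k))%g.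
Proof.
move=> Us Ut; have := marked_uniq Us Ut.
pose w := marker 2 :: map letter_neg (rev [seq k <- t | k \in J]) ++ inl (None, false) ::
  map letter_pos [seq k <- s | k \notin K].
pose w' := map letter_neg [seq k <- t | k \notin J] ++ [:: marker 3].
have Es : marked s t = [:: inl (None, true)] ++ marker 0 ::
    map letter_pos (rev [seq k <- s | k \in K]) ++ w ++ marker 1 :: w'.
  by rewrite /w /w' /marked /= -?catA.
have -> : marked (rcons s k) t = if k \in K then
    [:: inl (None, true)] ++ marker 0 :: letter_pos k ::
      map letter_pos (rev [seq k <- s | k \in K]) ++ w ++ marker 1 :: w' else
    ([:: inl (None, true), marker 0 & map letter_pos (rev [seq k <- s | k \in K])] ++ w)
      ++ letter_pos k :: marker 1 :: w'.
  rewrite /w /w' /marked !filter_rcons.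
  by case: ifP => _ /=; rewrite ?rev_rcons ?map_rcons ?cat_rcons -?catA /= -?catA.
rewrite Es; case: ifP => _ U; first by rewrite cycperm_after.
by rewrite cycperm_before // -?catA /= -?catA.
Qed.

Lemma cycperm_marked_y s t k : uniq s -> uniq (rcons t k) ->
  cycperm (marked s (rcons t k)) =
    (if k \in J then tperm (marker 2) (letter_neg k) * cycperm (marked s t)
     else cycperm (marked s t) * tperm (marker 3) (letter_neg k))%g.
Proof.
move=> Us Ut; have := marked_uniq Us Ut.
pose w := inl (None, true) :: marker 0 :: map letter_pos (rev [seq k <- s | k \in K]).
pose w' := map letter_neg (rev [seq k <- t | k \in J]).
pose w'' := inl (None, false) :: map letter_pos [seq k <- s | k \notin K] ++
  marker 1 :: map letter_neg [seq k <- t | k \notin J].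
have Es : marked s t = w ++ marker 2 :: w' ++ w'' ++ [:: marker 3].
  by rewrite /w /w' /w'' /marked /= -?catA.
have -> : marked s (rcons t k) = if k \in J then
    w ++ marker 2 :: letter_neg k :: w' ++ w'' ++ [:: marker 3] else
    (w ++ marker 2 :: w' ++ w'') ++ letter_neg k :: marker 3 :: [::].
  rewrite /w /w' /w'' /marked !filter_rcons.
  by case: ifP => _; rewrite ?rev_rcons ?map_rcons ?cat_rcons;
    do 3 rewrite -?catA /=.
rewrite Es; case: ifP => _ U; first by rewrite cycperm_after.
by rewrite cycperm_before //; do 3 rewrite -?catA /=.
Qed.

End MarkedWord.

Section Unmark.

Variable T : finType.

(** Without [m] in the word, [m] is a fixed point of the product, hence a cycle of its own; putting
    it back merges this cycle with another. *)
Lemma ncycles_unmark (mu : {perm T}) a w1 m w2 :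
    uniq (a :: w1 ++ m :: w2) -> mu m = m ->
  ncycles (mu * cycperm (a :: w1 ++ m :: w2))%g + 1
    = ncycles (mu * cycperm (a :: w1 ++ w2))%g.
Proof.
rewrite -2!cat_cons lastI !cat_rcons; move: (belast _ _) (last _ _) => r b U mum.
have /and3P[nbm mr U'] : [&& b != m, m \notin r ++ b :: w2 & uniq (r ++ b :: w2)].
  have := U; rewrite !cat_uniq /= !(inE, mem_cat, negb_or) (eq_sym m) -!andbA.
  by case/and5P=> -> -> -> -> /and4P[-> -> -> ->].
rewrite cycperm_after // mulgA mul_tperm -mulgA.
have mV : (mu^-1)%g m = m by rewrite -{1}mum permK.
rewrite mV; apply: ncycles_tperm_fix.
  by apply: contra nbm => /eqP e; rewrite -(permKV mu b) e mum.
by rewrite permM mum cycperm_notin.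
Qed.

End Unmark.

(** * The automaton *)

Section States.

(* A state is the list of the images of the four markers under a permutation
   [t]; it stands for the cycles of [t] followed by "mate, then next". *)

Definition swap_at (p q : nat) (st : seq nat) : seq nat :=
  [seq nth 0 st (if i == p then q else if i == q then p else i) | i <- iota 0 4].

Definition states : seq (seq nat) := permutations (iota 0 4).

Definition fixing (i : nat) (st : seq nat) : seq nat := swap_at i (index i st) st.

(** Making 3, 2 and 1 fixed points in turn reduces the state to the identity, which has four cycles;
    each nontrivial step splits off one cycle. *)
Definition ncycles_state (st : seq nat) : nat :=
  let st2 := fixing 3 st in let st1 := fixing 2 st2 in
  4 - ((3 != index 3 st) + (2 != index 2 st2) + (1 != index 1 st1)).

(* The word without letters is obtained from the cycle of markers (0 2 1 3) by
   inserting [a] before [marker 0] and [a^-] before [marker 1]. *)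
Definition verts0 (st : seq nat) : nat :=
  ncycles_state (swap_at 0 2 (swap_at 0 1 (swap_at 0 3 (swap_at 1 0 st)))).

(** These are the elements [p] and [q] of [ncycles_band]: [index] gives the preimage of a marker
    under [t]. *)
Definition port_x (st : seq nat) (b : bool) := if b then index 0 st else 1.
Definition port_y (st : seq nat) (b : bool) := if b then index 2 st else 3.

(* The choices are listed from the largest index to the smallest. *)
Fixpoint verts (st : seq nat) (ds : seq (bool * bool)) : nat :=
  if ds is d :: ds' then
    let p := port_x st d.1 in let q := port_y st d.2 in
    verts (swap_at p q st) ds' + (p == q)
  else verts0 st.

Lemma states_swap_at : all (fun st => all (fun p => all (fun q => swap_at p q st \in states)
  (iota 0 4)) (iota 0 4)) states.
Proof. by vm_compute. Qed.

Lemma states_fixing : all (fun st => fixing 1 (fixing 2 (fixing 3 st)) == iota 0 4) states.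
Proof. by vm_compute. Qed.

Lemma swap_at_states p q st : p < 4 -> q < 4 -> st \in states -> swap_at p q st \in states.
Proof.
move=> hp hq /(allP states_swap_at)/allP/(_ p).
by rewrite mem_iota => /(_ hp)/allP/(_ q); rewrite mem_iota; apply.
Qed.

End States.

(** * Cycle counts for marked ladder words *)

Section Ladder.

Variable n : nat.
Notation token := (token n).
Implicit Types (t : {perm token}) (st : seq nat).

Definition mate_fun (z : token) : token :=
  match z with inl (l, b) => inl (l, ~~ b) | inr m => inr m end.

Lemma mate_funK : involutive mate_fun.
Proof. by case=> [[l b]|m] //=; rewrite negbK. Qed.

Definition mate : {perm token} := perm (inv_inj mate_funK).

Definition letters : pred token := fun z => if z is inl _ then true else false.

Lemma letters_closed t : (forall m, t (inr m) = inr m) -> fclosed t letters.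
Proof.
move=> tm; apply: intro_closed; first exact: (fconnect_sym perm_inj).
move=> x y /eqP <-; case: x => // l _; rewrite unfold_in.
by case e: (t (inl l)) => [//|m]; rewrite -(tm m) in e; have := perm_inj e.
Qed.

Lemma ncycles_letters t :
  (forall m, t (inr m) = inr m) -> ncycles t = fcard t letters + 4.
Proof.
move=> tm; rewrite ncycles_fcard (n_compC letters); congr (_ + _).
have cC : #|[predC letters]| = 4.
  rewrite -[RHS](card_ord 4) -[RHS](card_image (@inr_inj (option 'I_n * bool) _)).
  apply: eq_card => -[l|m]; rewrite !inE; first by apply/esym/imageP => -[].
  by rewrite mem_image //; apply: inr_inj.
rewrite -[LHS]muln1 -[RHS]cC; apply: fcard_order_set; first exact: perm_inj.
  apply/fintype.subsetP => -[[] //|m _].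
  by rewrite inE (order_cycle (p := [:: inr m])) ?inE //= tm eqxx.
by move=> z z' /(letters_closed tm) e; rewrite !inE in e *; rewrite e.
Qed.

Lemma mateE z : mate z = mate_fun z.
Proof. by rewrite permE. Qed.

(** The [n + 1] letters, [a] included, give 2-cycles, and the four markers are fixed. *)
Lemma ncycles_mate : ncycles mate = n + 5.
Proof.
have mm m : mate (inr m) = inr m by rewrite mateE.
have cA : #|letters| = n.+1 * 2.
  have <- : #|{: option 'I_n * bool}| = n.+1 * 2.
    by rewrite card_prod card_option card_ord card_bool.
  rewrite -[RHS](card_image (@inl_inj _ 'I_4)).
  apply: eq_card => -[l|m]; rewrite ?inE; last by apply/esym/imageP => -[].
  by rewrite mem_image //; apply: inl_inj.
rewrite ncycles_letters // -[5]/(1 + 4) addnA addn1; congr (_ + _); apply/eqP.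
rewrite -(eqn_pmul2r (m := 2)) // -cA; apply/eqP; apply: fcard_order_set.
- exact: perm_inj.
- apply/fintype.subsetP => -[[l b] _|//].
  rewrite inE (order_cycle (p := [:: inl (l, b); inl (l, ~~ b)])) ?inE ?eqxx //.
    by rewrite /= !mateE /= negbK !eqxx.
  by rewrite /= inE andbT; apply/eqP => -[]; case: b.
- exact: letters_closed.
Qed.

Definition represents t st :=
  (forall l, t (inl l) = inl l) /\
  (forall i, i < 4 -> t (marker n i) = marker n (nth 0 st i)).

Lemma represents_swap_at p q t st : p < 4 -> q < 4 -> represents t st ->
  represents (tperm (marker n p) (marker n q) * t)%g (swap_at p q st).
Proof.
move=> hp hq [h1 h2]; split=> [l|i hi]; first by rewrite permM tpermD.
rewrite permM /swap_at (nth_map 0) ?size_iota // nth_iota // add0n permE /= !marker_eq //.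
by case: eqP => _; [|case: eqP => _]; rewrite h2.
Qed.

Lemma states_lt st i : st \in states -> i < 4 ->
  (index i st < 4) && (nth 0 st (index i st) == i).
Proof.
rewrite mem_permutations => h hi; have ist : i \in st by rewrite (perm_mem h) mem_iota.
by rewrite nth_index // eqxx andbT -[4](size_iota 0) -(perm_size h) index_mem.
Qed.

Lemma represents_inv t st i : represents t st -> st \in states -> i < 4 ->
  (t^-1)%g (marker n i) = marker n (index i st).
Proof.
move=> [_ h] hst hi; apply: (@perm_inj _ t); rewrite permKV.
by have /andP[h1 /eqP h2] := states_lt hst hi; rewrite h // h2.
Qed.

Lemma represents_iota t : represents t (iota 0 4) -> t = 1%g.
Proof.
move=> [h1 h2]; apply/permP => z; rewrite perm1; case: z => [l //|m].
have -> : inr m = marker n m by rewrite /marker inord_val.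
by rewrite h2 // nth_iota.
Qed.

Lemma ncycles_fixing t st i : represents t st -> st \in states -> i < 4 ->
  ncycles (t * mate)%g + (i != index i st) =
  ncycles (tperm (marker n i) (marker n (index i st)) * t * mate)%g.
Proof.
move=> rt hst hi; have /andP[h1 _] := states_lt hst hi.
have [e|ne] := eqVneq i (index i st); first by rewrite -e tperm1 mul1g addn0.
rewrite -[in RHS](@ncycles_tperm_fix _ _ (marker n (index i st)) (marker n i)).
- by rewrite tpermC !mulgA tperm2 mul1g.
- by rewrite marker_eq // eq_sym.
have [_ /(_ i hi) h2] := represents_swap_at hi h1 rt.
rewrite permM h2 permE /swap_at (nth_map 0) ?size_iota // nth_iota // add0n eqxx.
by have /andP[_ /eqP->] := states_lt hst hi.
Qed.

Lemma ncycles_represents t st : represents t st -> st \in states ->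
  ncycles (t * mate)%g = ncycles_state st + n + 1.
Proof.
move=> rt hst; set st2 := fixing 3 st; set st1 := fixing 2 st2.
have fx i r : i < 4 -> r \in states -> fixing i r \in states.
  by move=> hi hr; have /andP[h _] := states_lt hr hi; apply: swap_at_states.
have hst2 : st2 \in states by apply: fx.
have hst1 : st1 \in states by apply: fx.
have lt r i : r \in states -> i < 4 -> index i r < 4.
  by move=> hr hi; have /andP[] := states_lt hr hi.
have r2 : represents _ st2 := represents_swap_at (p := 3) isT (lt st 3 hst isT) rt.
have r1 : represents _ st1 := represents_swap_at (p := 2) isT (lt st2 2 hst2 isT) r2.
have r0 := represents_swap_at (p := 1) isT (lt st1 1 hst1 isT) r1.
have := ncycles_fixing (i := 1) r1 hst1 isT.
have := ncycles_fixing (i := 2) r2 hst2 isT.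
have := ncycles_fixing (i := 3) rt hst isT.
(* After the three fixings the state is the identity, so that only [mate] is left to count. *)
have /eqP e := allP states_fixing _ hst.
rewrite (represents_iota (t := _ * (_ * (_ * t)))%g); last by rewrite -e.
rewrite mul1g ncycles_mate /ncycles_state -/st2 -/st1.
move=> <- <-; case: (3 != _) (2 != _) (1 != _) => [] [] [] /=; lia.
Qed.

Variables K J : {set 'I_n}.

Let code (s : seq 'I_n) : seq (bool * bool) := [seq (k \in K, k \in J) | k <- rev s].

Lemma represents_port_x t st b : represents t st -> st \in states ->
  (if b then (t^-1)%g (marker n 0) else marker n 1) = marker n (port_x st b).
Proof. by move=> rt hst; case: b => //=; apply: represents_inv. Qed.

Lemma represents_port_y t st b : represents t st -> st \in states ->
  (if b then (t^-1)%g (marker n 2) else marker n 3) = marker n (port_y st b).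
Proof. by move=> rt hst; case: b => //=; apply: represents_inv. Qed.

Lemma port_x_lt st b : st \in states -> port_x st b < 4.
Proof. by case: b => //= /(states_lt (i := 0)) /(_ isT)/andP[]. Qed.

Lemma port_y_lt st b : st \in states -> port_y st b < 4.
Proof. by case: b => //= /(states_lt (i := 2)) /(_ isT)/andP[]. Qed.

Lemma ncycles_marked0 t st : represents t st -> st \in states ->
  ncycles (t * mate * cycperm (marked K J [::] [::]))%g = verts0 st + n.
Proof.
move=> rt hst.
pose a : token := inl (None, true); pose b : token := inl (None, false).
have U : uniq [:: a; marker n 0; marker n 2; b; marker n 1; marker n 3].
  exact: (marked_uniq K J (isT : uniq [::]) (isT : uniq [::])).
have U' : uniq [:: marker n 0; marker n 2; b; marker n 1; marker n 3] by case/andP: U.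
have U3 : uniq [:: marker n 0; marker n 2; marker n 1; marker n 3].
  by rewrite /= !inE !marker_eq.
have U2 : uniq [:: marker n 0; marker n 1; marker n 3] by rewrite /= !inE !marker_eq.
have U1 : uniq [:: marker n 0; marker n 3] by rewrite /= !inE !marker_eq.
have -> : cycperm (marked K J [::] [::]) =
    (cycperm [:: marker n 0; marker n 2; marker n 1; marker n 3]
     * (tperm (marker n 1) b * tperm (marker n 0) a))%g.
  rewrite mulgA -(cycperm_before (w1 := [:: _; _]) U').
  exact: (cycperm_before (w1 := [::]) U).
have nuE : cycperm [:: marker n 0; marker n 2; marker n 1; marker n 3] =
    (tperm (marker n 0) (marker n 2)
     * (tperm (marker n 0) (marker n 1) * tperm (marker n 0) (marker n 3)))%g.
  rewrite (cycperm_after (w1 := [::]) U3) (cycperm_after (w1 := [::]) U2).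
  rewrite (cycperm_after (w1 := [::]) U1) [cycperm ([::] ++ _)](_ : _ = 1%g) ?mulg1 //.
  by apply/permP => z; rewrite cycpermE // perm1 /=; case: eqP.
have [tl _] := rt.
(* Inserting [a] and [a^-] at the corners 0 and 1 exchanges their successors and costs one cycle,
   which balances the [+ 1] of [ncycles_represents]. *)
apply/eqP; rewrite -(eqn_add2r 1) mulgA ncyclesC (@ncycles_insert _ _ _ _ a b).
- rewrite nuE mulgA ncyclesC [X in ncycles X](_ : _ =
    (tperm (marker n 0) (marker n 2)
     * (tperm (marker n 0) (marker n 1) * (tperm (marker n 0) (marker n 3)
       * (tperm (marker n 1) (marker n 0) * t)))) * mate)%g; last by rewrite !mulgA.
  rewrite (ncycles_represents (st :=
    swap_at 0 2 (swap_at 0 1 (swap_at 0 3 (swap_at 1 0 st))))) //.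
    by do 4 (apply: represents_swap_at => //).
  by do 4 (apply: swap_at_states => //).
- by rewrite !permM tl mateE cycperm_notin.
- by rewrite !permM tl mateE cycperm_notin.
- by [].
- by rewrite marker_eq.
- by [].
- by [].
Qed.

(** Removing the last letter composes [t] with the transposition of its two ports, hence the general
    [t]. The difference [n - size s] counts the letters not yet placed, which are still 2-cycles. *)
Lemma ncycles_marked t st s : represents t st -> st \in states -> uniq s ->
  ncycles (t * mate * cycperm (marked K J s s))%g + size s = verts st (code s) + n.
Proof.
elim/last_ind: s t st => [|s k IHs] t st rt hst Us.
  by rewrite addn0 (ncycles_marked0 rt hst).
move: (Us); rewrite rcons_uniq => /andP[ks Us'].
have U4 : uniq
    [:: marker n 0; marker n 1; marker n 2; marker n 3; letter_pos k; letter_neg k].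
  by rewrite /= !inE !marker_eq //= andbT; apply/eqP => -[].
have nu0 : uniq (marked K J s s) by apply: marked_uniq.
have [tl _] := rt.
have := @ncycles_band _ t mate (cycperm (marked K J s s)) _ _ _ _ _ _
  (k \in K) (k \in J) U4 (tl _) (tl _).
cbv zeta; rewrite !mateE -cycperm_marked_x // -cycperm_marked_y //.
rewrite !cycperm_notin ?mem_marked_pos ?mem_marked_neg //.
move=> /(_ erefl erefl erefl erefl erefl erefl) /=.
rewrite !(represents_port_x _ rt hst) !(represents_port_y _ rt hst).
rewrite marker_eq ?port_x_lt ?port_y_lt //.
have hp := port_x_lt (k \in K) hst; have hq := port_y_lt (k \in J) hst.
have := IHs _ _ (represents_swap_at hp hq rt) (swap_at_states hp hq hst) Us'.
rewrite /code rev_rcons size_rcons /= -!mulgA.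
move=> + e; rewrite -{}e; case: eqP => _ /=; lia.
Qed.

End Ladder.

(** * From cycles to vertices and genus *)

Section Genus.

Variable n : nat.
Notation token := (token n).
Implicit Types K J : {set 'I_n}.

Definition code (KT : {set 'I_n} * {set 'I_n}) : seq (bool * bool) :=
  [seq (k \in KT.1, k \in KT.2) | k <- rev (enum 'I_n)].

Lemma size_code KT : size (code KT) = n.
Proof. by rewrite size_map size_rev size_enum_ord. Qed.

Lemma next_tnth (T : eqType) (w : seq T) (i : 'I_(size w)) : uniq w ->
  next w (tnth (in_tuple w) i) = tnth (in_tuple w) (ordS i).
Proof.
case: w i => [|a w] i U; first by case: i.
rewrite !(tnth_nth a) next_nth mem_nth // index_uniq //=.
have := ltn_ord i; rewrite ltnS leq_eqVlt => /orP[/eqP e|hi].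
  by rewrite [X in nth _ _ X]e e modnn nth_default.
by rewrite modn_small //=; apply: set_nth_default.
Qed.

(** A corner is identified with the side that starts there. It is glued to the end of the mate of
    this side, where the next side starts, so the vertices are the cycles on letters; the 4 stands
    for the markers, which are fixed. *)
Lemma nb_vertices_cycles (w : seq (sletter (letter n))) :
    uniq w -> (forall l, l \in w) ->
  nb_vertices w + 4 = ncycles (mate n * cycperm (map inl w))%g.
Proof.
move=> Uw win; pose phi := (mate n * cycperm (map inl w))%g.
have U : uniq (map inl w : seq token) by rewrite map_inj_uniq // => ? ? [].
pose h (i : 'I_(size w)) : token := inl (side i).
have hE i : cycperm (map inl w) (h i) = h (ordS i).
  by rewrite cycpermE // next_map ?next_tnth // => ? ? [].
have phiE (i j : 'I_(size w)) : glued i j -> phi (h i) = h (ordS j).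
  move=> /andP[/eqP e1 e2]; rewrite permM mateE -hE; congr (cycperm _ _).
  rewrite /h; case: (side i) (side j) e1 e2 => [l b] [l' b'] /= <-.
  by case: b b' => [] [].
have mates (i : 'I_(size w)) : exists j, glued i j.
  have /(nthP (pos None))[j hj e] := win ((side i).1, ~~ (side i).2).
  exists (Ordinal hj).
  rewrite /glued /side (tnth_nth (pos None) _ (Ordinal hj)) /= e /= eqxx.
  by case: (_.2).
have gs (i j : 'I_(size w)) : glued i j = glued j i.
  by rewrite /glued eq_sym [X in _ && ~~ X]eq_sym.
have hI : injective h.
  move=> i j [] /eqP; rewrite /side !(tnth_nth (pos None)) /= nth_uniq //.
  by move=> /eqP; apply: val_inj.
pose e : rel token := fun u v => (phi u == v) || (phi v == u).
have eE (c d : 'I_(size w)) : corner_glued c d = e (h c) (h d).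
  apply/existsP/orP => [[i /existsP[j /andP[g]]]|[/eqP E|/eqP E]].
  - case/orP=> /andP[/eqP-> /eqP->]; first by left; rewrite (phiE _ _ g).
    by right; rewrite (phiE j i) // gs.
  - have [j g] := mates c; exists c; apply/existsP; exists j; rewrite g eqxx /=.
    by rewrite -(inj_eq hI) -E (phiE _ _ g) eqxx.
  - have [i g] := mates d; exists i; apply/existsP; exists d; rewrite gs g eqxx /= andbT.
    by rewrite -[c == ordS i](inj_eq hI) -E (phiE _ _ g) eqxx orbT.
have phim m : phi (inr m) = inr m.
  by rewrite permM mateE cycperm_notin //; apply/mapP => -[].
rewrite -/phi (ncycles_letters phim); congr (_ + _).
have fs := fconnect_sym (@perm_inj _ phi).
have ec : connect (frel phi) =2 connect e.
  move=> u v; apply/idP/idP; apply: connect_sub => {u v} u v.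
    by move=> uv; apply: connect1; rewrite /e; move: uv => /= ->.
  by case/orP=> /eqP <-; [|rewrite fs]; apply: fconnect1.
have es : connect_sym e by move=> u v; rewrite -!ec fs.
have ecl : closed e (@letters n).
  have cl := letters_closed phim.
  by move=> u v /orP[]/eqP <-; [apply: cl|apply/esym; apply: cl]; rewrite /=.
rewrite (eq_n_comp ec) (adjunction_n_comp h es (e' := @corner_glued _ w)).
- by apply: eq_n_comp_r => i; rewrite !inE.
- exact: sym_connect_sym (@corner_glued_sym _ w).
- exact: ecl.
apply: strict_adjunction => //; first exact: sym_connect_sym (@corner_glued_sym _ w).
- apply/fintype.subsetP => -[l _|//]; apply/codomP.
  have /(nthP (pos None))[j hj <-] := win l.
  by exists (Ordinal hj); rewrite /h /side (tnth_nth (pos None)).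
Qed.

Lemma mem_ladder5 (KT : {set 'I_n} * {set 'I_n}) l : l \in ladder5 KT.
Proof.
case: KT => K J; rewrite /ladder5 /R1 /R2 /R3 /R4 /pos /neg /=.
case: l => [[k|] b]; rewrite !(inE, mem_cat); last by case: b; rewrite ?orbT.
have mp (c : bool) (A : {set 'I_n}) :
    (Some k, c) \in [seq (Some i, c) | i <- rev (enum A)] = (k \in A).
  by rewrite (mem_map (f := fun i => (Some i, c))) ?mem_rev ?mem_enum // => ? ? [].
have mp' (c : bool) (A : {set 'I_n}) :
    (Some k, c) \in [seq (Some i, c) | i <- enum (~: A)] = (k \notin A).
  by rewrite (mem_map (f := fun i => (Some i, c))) ?mem_enum ?inE // => ? ? [].
case: b; first by rewrite mp mp'; case: (k \in K); rewrite ?orbT.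
by rewrite mp mp'; case: (k \in J); rewrite ?orbT.
Qed.

Lemma nb_vertices_ladder (KT : {set 'I_n} * {set 'I_n}) :
  nb_vertices (ladder5 KT) = verts (iota 0 4) (code KT).
Proof.
case: KT => K J; pose s := enum 'I_n.
have Us : uniq s by apply: enum_uniq.
have U := marked_uniq K J Us Us.
have sub (a m : token) w1 w2 : uniq (a :: w1 ++ m :: w2) -> uniq (a :: w1 ++ w2).
  exact: (subseq_uniq (cat_subseq (subseq_refl (a :: w1)) (subseq_cons w2 m))).
have mm i : mate n (marker n i) = marker n i by rewrite mateE.
pose x1 : seq token := map (@letter_pos n) (rev [seq k <- s | k \in K]).
pose x2 : seq token := map (@letter_pos n) [seq k <- s | k \notin K].
pose y1 : seq token := map (@letter_neg n) (rev [seq k <- s | k \in J]).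
pose y2 : seq token := map (@letter_neg n) [seq k <- s | k \notin J].
pose a : token := inl (None, true); pose b : token := inl (None, false).
have lE : map inl (ladder5 (K, J)) = a :: x1 ++ y1 ++ b :: x2 ++ y2.
  have eA (A : {set 'I_n}) : enum A = [seq k <- s | k \in A] by rewrite /s enumT.
  have eC (A : {set 'I_n}) : enum (~: A) = [seq k <- s | k \notin A].
    by rewrite eA; apply: eq_filter => k; rewrite inE.
  rewrite /ladder5 /R1 /R2 /R3 /R4 /= !eC !eA !(map_cat, map_cons) /=.
  by rewrite -!map_comp.
(* The markers are removed one at a time; each removal adds a cycle, which accounts for the 4 in
   [nb_vertices_cycles]. *)
have U0 : uniq (a :: [::] ++ marker n 0 :: x1 ++ marker n 2 :: y1
    ++ b :: x2 ++ marker n 1 :: y2 ++ [:: marker n 3]) := U.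
have U1 := sub _ _ _ _ U0; have e1 := ncycles_unmark U0 (mm 0).
have U2 := sub _ _ _ _ U1; have e2 := ncycles_unmark U1 (mm 2).
have U2' : uniq (a :: (x1 ++ y1 ++ b :: x2) ++ marker n 1 :: y2 ++ [:: marker n 3]).
  by rewrite -?catA /= -?catA.
have U3 := sub _ _ _ _ U2'; have e3 := ncycles_unmark U2' (mm 1).
have U3' : uniq (a :: (x1 ++ y1 ++ b :: x2 ++ y2) ++ marker n 3 :: [::]).
  by move: U3; rewrite -?catA /= -?catA.
have U4 := sub _ _ _ _ U3'; have e4 := ncycles_unmark U3' (mm 3).
have rid : represents (1%g : {perm token}) (iota 0 4).
  by split=> [l|i hi]; rewrite perm1 ?nth_iota.
have Ul : uniq (ladder5 (K, J)).
  have : uniq (map inl (ladder5 (K, J)) : seq token).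
    by rewrite lE; move: U4; rewrite cats0 -?catA /= -?catA.
  exact: map_uniq.
have := ncycles_marked K J rid (isT : iota 0 4 \in states) Us.
have := nb_vertices_cycles Ul (mem_ladder5 _).
rewrite lE mul1g size_enum_ord => e5 /addIn e6.
rewrite -[RHS]e6; apply/eqP; rewrite -(eqn_add2r 4) e5.
apply/eqP; move: e1 e2 e3 e4; rewrite cats0.
rewrite -?catA /= -?catA => e1 e2 e3 e4.
by rewrite -[in LHS]e4 -e3 -e2 -e1 -!addnA.
Qed.

(** The hypothesis is Euler's formula for one face and [n + 1] edges. *)
Lemma genus5E (KT : {set 'I_n} * {set 'I_n}) g :
  2 * g + verts (iota 0 4) (code KT) = n + 2 -> genus5 KT = g.
Proof.
have sz : size (ladder5 KT) = n.*2.+2.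
  case: KT => K J; rewrite /ladder5 /R1 /R2 /R3 /R4 /= !size_cat /= !size_cat.
  rewrite !size_map !size_rev -!cardE.
  have := cardsC K; have := cardsC J; rewrite card_ord.
  by move: #|J| #|K| #|~: J| #|~: K| => j k j' k'; lia.
move=> e; rewrite /genus5 /genus /euler_char /nb_edges sz /= doubleK nb_vertices_ladder.
lia.
Qed.

End Genus.

(** * Genus counts and the reduced automaton *)

Definition next_state (st : seq nat) (d : bool * bool) : seq nat :=
  swap_at (port_x st d.1) (port_y st d.2) st.

(** [verts0] serves as a potential: its variation turns the change in the number of vertices into a
    natural increment of the genus. *)
Definition genus_step (st : seq nat) (d : bool * bool) : nat :=
  (1 + verts0 st - verts0 (next_state st d)
     - (port_x st d.1 == port_y st d.2))./2.

Fixpoint genus_of (st : seq nat) (ds : seq (bool * bool)) : nat :=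
  if ds is d :: ds' then genus_of (next_state st d) ds' + genus_step st d else 0.

Definition bits : seq (bool * bool) :=
  [:: (true, true); (true, false); (false, true); (false, false)].

(* The truncated subtractions in [genus_step] are exact. *)
Lemma genus_step_eq : all (fun st => all (fun d =>
  2 * genus_step st d + verts0 (next_state st d)
    + (port_x st d.1 == port_y st d.2) == 1 + verts0 st) bits) states.
Proof. by vm_compute. Qed.

Lemma mem_bits d : d \in bits.
Proof. by case: d => [] [] []. Qed.

Lemma next_state_in st d : st \in states -> next_state st d \in states.
Proof. by move=> hst; apply: swap_at_states; rewrite ?port_x_lt ?port_y_lt. Qed.

Lemma genus_of_verts st ds : st \in states ->
  2 * genus_of st ds + verts st ds = size ds + verts0 st.
Proof.
elim: ds st => [|d ds IHds] st hst //=.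
have := IHds _ (next_state_in d hst).
have /eqP := allP (allP genus_step_eq _ hst) _ (mem_bits d).
rewrite -/(next_state st d); lia.
Qed.

Lemma genus5_code n (KT : {set 'I_n} * {set 'I_n}) :
  genus5 KT = genus_of (iota 0 4) (code KT).
Proof.
(* [verts0 (iota 0 4)] computes to 2, the number of vertices of the sphere [a a^-]. *)
by apply: genus5E; rewrite genus_of_verts // size_code.
Qed.

(* States of the same class have the same genus counts; the classes come from
   partition refinement of the automaton.  The entry
   [(c, k)] of [class_steps] is a transition to the class [c] raising the genus
   by [k]. *)
Definition classes : seq (seq (seq nat)) :=
  [:: [:: [:: 1; 2; 3; 0] ];
   [:: [:: 3; 1; 2; 0]; [:: 0; 2; 1; 3] ];
   [:: [:: 3; 0; 1; 2] ];
   [:: [:: 0; 1; 3; 2]; [:: 1; 0; 2; 3] ];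
   [:: [:: 1; 0; 3; 2] ];
   [:: [:: 3; 2; 1; 0] ];
   [:: [:: 2; 1; 3; 0]; [:: 1; 2; 0; 3]; [:: 1; 3; 2; 0]; [:: 0; 2; 3; 1] ];
   [:: [:: 3; 1; 0; 2]; [:: 3; 0; 2; 1]; [:: 2; 0; 1; 3]; [:: 0; 3; 1; 2] ];
   [:: [:: 0; 1; 2; 3] ];
   [:: [:: 2; 0; 3; 1]; [:: 1; 3; 0; 2] ];
   [:: [:: 2; 3; 1; 0]; [:: 3; 2; 0; 1] ];
   [:: [:: 2; 1; 0; 3]; [:: 0; 3; 2; 1] ];
   [:: [:: 2; 3; 0; 1] ] ].

Definition class (st : seq nat) : nat := find (fun c => st \in c) classes.

Definition class_steps : seq (seq (nat * nat)) :=
  [:: [:: (0, 0); (0, 0); (4, 0); (4, 0) ];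
   [:: (1, 0); (5, 0); (7, 0); (7, 0) ];
   [:: (5, 0); (5, 0); (5, 0); (5, 0) ];
   [:: (6, 0); (6, 0); (6, 0); (6, 0) ];
   [:: (0, 1); (0, 1); (0, 1); (0, 1) ];
   [:: (2, 1); (2, 1); (5, 0); (5, 0) ];
   [:: (0, 1); (3, 1); (6, 0); (9, 0) ];
   [:: (1, 1); (1, 1); (10, 0); (10, 0) ];
   [:: (1, 1); (1, 1); (11, 0); (11, 0) ];
   [:: (6, 1); (6, 1); (6, 1); (6, 1) ];
   [:: (5, 1); (7, 1); (7, 1); (10, 0) ];
   [:: (6, 1); (6, 1); (8, 1); (12, 0) ];
   [:: (10, 1); (10, 1); (11, 1); (11, 1) ] ].

(** Agreement up to order suffices, since the counts are sums over all transitions. *)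
Lemma class_stepsP : all (fun st =>
  perm_eq [seq (class (next_state st d), genus_step st d) | d <- bits]
          (nth [::] class_steps (class st))) states.
Proof. by vm_compute. Qed.

Fixpoint words (n : nat) : seq (seq (bool * bool)) :=
  if n is n'.+1 then [seq d :: ds | d <- bits, ds <- words n'] else [:: [::]].

Fixpoint class_count (c n i : nat) : nat :=
  if n is n'.+1 then
    sumn [seq if s.2 <= i then class_count s.1 n' (i - s.2) else 0
         | s <- nth [::] class_steps c]
  else i == 0.

Lemma count_genus_of st n i : st \in states ->
  count (fun ds => genus_of st ds == i) (words n) = class_count (class st) n i.
Proof.
elim: n st i => [|n IHn] st i hst; first by rewrite /= addn0 eq_sym.
rewrite [LHS]/= [RHS]/= -(perm_sumn (perm_map _ (allP class_stepsP _ hst))).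
have sub d : count (fun ds => genus_of st ds == i) [seq d :: ds | ds <- words n] =
    if genus_step st d <= i then
      class_count (class (next_state st d)) n (i - genus_step st d) else 0.
  rewrite count_map -(IHn _ _ (next_state_in d hst)).
  case: leqP => h.
    by apply: eq_count => ds /=; apply/eqP/eqP; lia.
  by rewrite (eq_count (a2 := pred0)) ?count_pred0 // => ds /=; apply/eqP; lia.
by rewrite !count_cat !sub.
Qed.

Lemma mem_words n ds : (ds \in words n) = (size ds == n).
Proof.
elim: n ds => [|n IHn] ds; first by case: ds.
apply/allpairsP/idP => [[[d ds'] /= [_ h ->]]|]; first by rewrite /= eqSS -IHn.
case: ds => [//|d ds]; rewrite /= eqSS -IHn => h.
by exists (d, ds); rewrite mem_bits.
Qed.

Lemma size_words n : size (words n) = 4 ^ n.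
Proof.
elim: n => [//|n IHn]; rewrite [words _]/= !size_cat !size_map IHn expnS /=; lia.
Qed.

Lemma code_inj n : injective (@code n).
Proof.
move=> [K J] [K' J'] /= e.
have h k : (k \in K, k \in J) = (k \in K', k \in J').
  by move/eq_in_map: e; apply; rewrite mem_rev mem_enum.
by congr pair; apply/setP => k; case: (h k).
Qed.

(** [code] is injective and there are [4 ^ n] pairs, so every word is the code of exactly one pair.
    Class 8 is that of the identity, the initial state. *)
Lemma g5_class_count n i : g5 n i = class_count 8 n i.
Proof.
have e0 : iota 0 4 \in states by [].
rewrite -[8]/(class (iota 0 4)) -(count_genus_of n i e0) /g5 cardE.
have -> : enum [set KT | genus5 KT == i] =
    [seq KT <- enum {: {set 'I_n} * {set 'I_n}} | genus_of (iota 0 4) (code KT) == i].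
  rewrite [in RHS]enumT; apply: eq_filter => KT.
  by rewrite -genus5_code; apply: in_set.
rewrite size_filter -(count_map (@code n) (fun ds => genus_of (iota 0 4) ds == i)).
apply/seq.permP; pose s := [seq code KT | KT <- enum {: {set 'I_n} * {set 'I_n}}].
have Us : uniq s by rewrite map_inj_uniq ?enum_uniq //; apply: code_inj.
have sub : {subset s <= words n}.
  by move=> _ /mapP[KT _ ->]; rewrite mem_words size_code.
have sz : size (words n) <= size s.
  rewrite size_words size_map -cardE card_prod -cardsT -powersetT card_powerset.
  by rewrite cardsT card_ord -expnMn.
have [_ e] := uniq_min_size Us sub sz.
by apply: uniq_perm => //; apply: leq_size_uniq Us sub sz.
Qed.

(** * Closed forms *)

Delimit Scope Z_scope with BZ.

(* Polynomials in [x] are represented by their coefficient functions;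
   [shiftZ] is the multiplication by [x]. *)
Definition shiftZ (f : nat -> Z) (i : nat) : Z := if i is i'.+1 then f i' else 0%BZ.

Definition class_countZ c n i : Z := Z.of_nat (class_count c n i).
Arguments class_countZ : simpl never.

Lemma class_countZ_rec c n i : class_countZ c n.+1 i =
  foldr (fun s z => Z.add (iter s.2 shiftZ (class_countZ s.1 n) i) z) 0%BZ
    (nth [::] class_steps c).
Proof.
rewrite /class_countZ /=; move: (nth _ _ _) => r.
elim: r => [//|s r IHr] /=; rewrite Nat2Z.inj_add IHr; congr Z.add.
elim: s.2 i {IHr} => [|k IHk] i /=; first by rewrite subn0.
by case: i => [|i] //=; rewrite -IHk ltnS subSS.
Qed.

Fixpoint lucas_seq (a b : Z) (f0 f1 : nat -> Z) (n : nat) : nat -> Z :=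
  match n with
  | 0 => f0
  | 1 => f1
  | (n'.+1 as n1).+1 => fun i =>
      (a * lucas_seq a b f0 f1 n1 i + b * shiftZ (lucas_seq a b f0 f1 n') i)%BZ
  end.

Lemma lucas_seq_rec a b f0 f1 n i : lucas_seq a b f0 f1 n.+2 i =
  (a * lucas_seq a b f0 f1 n.+1 i + b * shiftZ (lucas_seq a b f0 f1 n) i)%BZ.
Proof. by []. Qed.

Definition delta0 (i : nat) : Z := if i is 0 then 1%BZ else 0%BZ.
Definition zero (i : nat) : Z := 0%BZ.

(* The generating series in [z] of [Qs], [Ws], [Es] and [Vs] are
   [z / (1 - 2 z - 8 x z^2)], [z / (1 - z - 8 x z^2)],
   [(1 + (1 - 3 x) z) / (1 - 4 x z^2)] and
   [(z + z^2) / ((1 - z) (1 - z - 8 x z^2))]. *)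
Definition Qs := lucas_seq 2 8 zero delta0.
Definition Ws := lucas_seq 1 8 zero delta0.
Definition Es := lucas_seq 0 4 delta0 (fun i => delta0 i - 3 * shiftZ delta0 i)%BZ.
Fixpoint Vs (n : nat) (i : nat) : Z :=
  if n is n'.+1 then (Vs n' i + Ws n i + Ws n' i)%BZ else 0%BZ.

(** The system is block triangular: 0, 4 and 2, 5 stand alone; 3, 6, 9 depend on the first block, 1,
    7, 10 on the second, and 8, 11, 12 on these last two. *)
Definition closed_forms (n : nat) : Prop :=
  forall i,
  let q j := (Qs n.+1 j + 2 * Qs n j)%BZ in
  let r j := (Qs n.+1 j + 2 * shiftZ (Qs n) j)%BZ in
  [/\ class_countZ 0 n i = q i,
      class_countZ 5 n i = r i,
      class_countZ 6 n i = (shiftZ q i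
        + (Ws n.+1 i + Ws n i) - shiftZ (fun j => Ws n.+1 j + Ws n j) i)%BZ &
  [/\ class_countZ 1 n i = (r i + 2 * Vs n i - 2 * shiftZ (Vs n) i)%BZ,
      class_countZ 10 n i =
        (let w j := (Ws n.+1 j + 4 * shiftZ (Ws n) j - 2 * shiftZ (Vs n) j)%BZ in
         shiftZ r i + w i - shiftZ w i)%BZ &
      class_countZ 11 n i = (6 * shiftZ (shiftZ (Qs n)) i
        + 6 * (shiftZ (Ws n) i - shiftZ (shiftZ (Ws n)) i) + Es n i)%BZ]].

Lemma class_countZ_recs n i :
  [/\ class_countZ 0 n.+1 i = (2 * class_countZ 0 n i + 2 * class_countZ 4 n i)%BZ,
      class_countZ 1 n.+1 i =
        (class_countZ 1 n i + class_countZ 5 n i + 2 * class_countZ 7 n i)%BZ,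
      class_countZ 2 n.+1 i = (4 * class_countZ 5 n i)%BZ &
      class_countZ 3 n.+1 i = (4 * class_countZ 6 n i)%BZ] /\
  [/\ class_countZ 4 n.+1 i = (4 * shiftZ (class_countZ 0 n) i)%BZ,
      class_countZ 5 n.+1 i =
        (2 * shiftZ (class_countZ 2 n) i + 2 * class_countZ 5 n i)%BZ,
      class_countZ 6 n.+1 i = (shiftZ (class_countZ 0 n) i
        + shiftZ (class_countZ 3 n) i + class_countZ 6 n i + class_countZ 9 n i)%BZ &
      class_countZ 7 n.+1 i =
        (2 * shiftZ (class_countZ 1 n) i + 2 * class_countZ 10 n i)%BZ] /\
  [/\ class_countZ 8 n.+1 i =
        (2 * shiftZ (class_countZ 1 n) i + 2 * class_countZ 11 n i)%BZ,
      class_countZ 9 n.+1 i = (4 * shiftZ (class_countZ 6 n) i)%BZ,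
      class_countZ 10 n.+1 i = (shiftZ (class_countZ 5 n) i
        + 2 * shiftZ (class_countZ 7 n) i + class_countZ 10 n i)%BZ,
      class_countZ 11 n.+1 i = (2 * shiftZ (class_countZ 6 n) i
        + shiftZ (class_countZ 8 n) i + class_countZ 12 n i)%BZ &
      class_countZ 12 n.+1 i = (2 * shiftZ (class_countZ 10 n) i
        + 2 * shiftZ (class_countZ 11 n) i)%BZ].
Proof.
by do 2 (split; [by split; rewrite class_countZ_rec;
      cbn [nth class_steps foldr ssrnat.iter snd fst]; lia|]);
  split; rewrite class_countZ_rec;
  cbn [nth class_steps foldr ssrnat.iter snd fst]; lia.
Qed.

(* The classes missing from [closed_forms] are determined by the previous
   index, whence the induction on two consecutive indices. *)
Lemma closed_forms_all n : closed_forms n /\ closed_forms n.+1.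
Proof.
have recQ m i : Qs m.+2 i = (2 * Qs m.+1 i + 8 * shiftZ (Qs m) i)%BZ by [].
have recW m i : Ws m.+2 i = (Ws m.+1 i + 8 * shiftZ (Ws m) i)%BZ.
  by rewrite /Ws lucas_seq_rec; lia.
have recE m i : Es m.+2 i = (4 * shiftZ (Es m) i)%BZ.
  by rewrite /Es lucas_seq_rec; lia.
have recV m i : Vs m.+1 i = (Vs m i + Ws m.+1 i + Ws m i)%BZ by [].
elim: n => [|n [IH0 IH1]].
  split; case=> [|[|[|i]]]; split; try split; by vm_compute.
split=> // i.
have e0 j : _ := let: And4 h _ _ _ := IH0 j in h.
have e5 j : _ := let: And4 _ h _ _ := IH0 j in h.
have e6 j : _ := let: And4 _ _ h _ := IH0 j in h.
have e1 j : _ := let: And4 _ _ _ (And3 h _ _) := IH0 j in h.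
have e10 j : _ := let: And4 _ _ _ (And3 _ h _) := IH0 j in h.
have e11 j : _ := let: And4 _ _ _ (And3 _ _ h) := IH0 j in h.
have f0 j : _ := let: And4 h _ _ _ := IH1 j in h.
have f5 j : _ := let: And4 _ h _ _ := IH1 j in h.
have f6 j : _ := let: And4 _ _ h _ := IH1 j in h.
have f1 j : _ := let: And4 _ _ _ (And3 h _ _) := IH1 j in h.
have f10 j : _ := let: And4 _ _ _ (And3 _ h _) := IH1 j in h.
have f11 j : _ := let: And4 _ _ _ (And3 _ _ h) := IH1 j in h.
have r2 j : _ := let: conj (And4 _ _ h _) _ := class_countZ_recs n j in h.
have r3 j : _ := let: conj (And4 _ _ _ h) _ := class_countZ_recs n j in h.
have r4 j : _ := let: conj _ (conj (And4 h _ _ _) _) := class_countZ_recs n j in h.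
have r7 j : _ := let: conj _ (conj (And4 _ _ _ h) _) := class_countZ_recs n j in h.
have r8 j : _ := let: conj _ (conj _ (And5 h _ _ _ _)) := class_countZ_recs n j in h.
have r9 j : _ := let: conj _ (conj _ (And5 _ h _ _ _)) := class_countZ_recs n j in h.
have r12 j : _ := let: conj _ (conj _ (And5 _ _ _ _ h)) := class_countZ_recs n j in h.
have [[s0 s1 _ _] [[_ s5 s6 _] [_ _ s10 s11 _]]] := class_countZ_recs n.+1 i.
move: r2 r3 r4 r7 r8 r9 r12 s0 s1 s5 s6 s10 s11.
move: e0 e1 e5 e6 e10 e11 f0 f1 f5 f6 f10 f11.
cbv zeta => e0 e1 e5 e6 e10 e11 f0 f1 f5 f6 f10 f11.
move=> r2 r3 r4 r7 r8 r9 r12 s0 s1 s5 s6 s10 s11.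
have close := (r2, r3, r4, r7, r8, r9, r12, f0, f1, f5, f6, f10, f11,
  e0, e1, e5, e6, e10, e11, recV, recE).
(* Splitting off [i = 0, 1, 2] makes the nested shifts compute; linear identities remain. *)
by split; last split; rewrite ?(s0, s1, s5, s6, s10, s11);
  clear - close recQ recW; case: i => [|[|[|i]]];
  do 4 (cbn [shiftZ]; rewrite ?close); do 2 (cbn [shiftZ]; rewrite ?recQ ?recW);
  cbn [shiftZ]; lia.
Qed.

(* The number of [j]-edge matchings of the cycle of length [n]. *)
Fixpoint lucas (n j : nat) : nat :=
  match n with
  | 0 => if j is 0 then 2 else 0
  | 1 => if j is 0 then 1 else 0
  | (n'.+1 as n1).+1 => lucas n1 j + (if j is j'.+1 then lucas n' j' else 0)
  end.

Arguments lucas : simpl never.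

Lemma lucas_rec n j : lucas n.+2 j = lucas n.+1 j + (if j is j'.+1 then lucas n j' else 0).
Proof. by []. Qed.

Lemma lucas_small n j : n < 2 * j -> lucas n j = 0.
Proof.
case: j => [|j]; first by rewrite muln0.
elim/ltn_ind: n j => -[|[|n]] IHn j // h.
rewrite lucas_rec (IHn n.+1) //; last lia.
by case: j h => [|j] h; [lia | rewrite (IHn n) //; lia].
Qed.

Lemma lucas0 n : 0 < n -> lucas n 0 = 1.
Proof. by elim/ltn_ind: n => -[|[|n]] IHn // _; rewrite lucas_rec addn0 IHn. Qed.

(** The two terms count the matchings of the cycle that avoid, respectively contain, a given
    edge. *)
Lemma lucas_bin m j : lucas (m + j.+1).+1 j.+1 = 'C(m.+1, j.+1) + 'C(m, j).
Proof.
elim: m j => [|m IHm] [|j] //; first by rewrite lucas_small //; lia.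
  by rewrite addSn lucas_rec IHm /= lucas0 ?addn1 // !bin1 !bin0; lia.
by rewrite addSn lucas_rec IHm /= addnS IHm [in RHS]binS (binS m j); lia.
Qed.

(** This is the usual formula with the factor [n / (n - j)], multiplied out. *)
Lemma lucas_binM n j : 2 * j <= n -> 0 < n -> (n - j) * lucas n j = n * 'C(n - j, j).
Proof.
case: j => [|j] h n0; first by rewrite lucas0 // subn0 bin0.
have [m e] : exists m, n = (m + j.+1).+1 by exists (n - j.+2); lia.
rewrite {1 2}e lucas_bin (_ : n - j.+1 = m.+1); last lia.
rewrite (_ : (m + j.+1).+1 - j.+1 = m.+1); last lia.
by rewrite mulnDr mul_bin_diag e -mulnDl; congr (_ * _); lia.
Qed.

(** The factor [n - j] is cancelled between the binomial formulas for [j] and [j + 1]; for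
    [n = 2 j + 1] both sides vanish. *)
Lemma lucas_ratio n j : 2 * j < n ->
  (j + 1) * (n - j - 1) * lucas n j.+1 = (n - 2 * j) * (n - 2 * j - 1) * lucas n j.
Proof.
move=> h; have [h2|h2] := leqP (2 * j.+1) n; last first.
  by rewrite lucas_small // muln0 (_ : n - 2 * j - 1 = 0) ?muln0 //; lia.
apply/eqP; rewrite -(eqn_pmul2l (m := n - j)); last lia.
have e1 := lucas_binM (ltnW h) (leq_ltn_trans (leq0n _) h).
have e2 := lucas_binM h2 (leq_ltn_trans (leq0n _) h).
have e3 := mul_bin_left (n - j.+1) j.
have e4 := mul_bin_down (n - j) j.
have [b eb] : exists b, n - j.+1 - j = b by eexists.
have [a ea] : exists a, n - j.+1 = a by eexists.
have -> : n - 2 * j = b.+1 by lia.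
have -> : b.+1 - 1 = b by lia.
have -> : n - j - 1 = a by lia.
have en : n - j = a.+1 by lia.
have en' : n - j - j = b.+1 by lia.
rewrite eb in e3; rewrite ea in e2 e3; rewrite en' en /= in e4; rewrite en in e1 *.
apply/eqP; transitivity (a.+1 * (j.+1 * (a * lucas n j.+1))); first by ring.
rewrite e2; transitivity (a.+1 * (n * (j.+1 * 'C(a, j.+1)))); first by ring.
rewrite e3; transitivity (n * b * (a.+1 * 'C(a, j))); first by ring.
rewrite e4; transitivity (b.+1 * b * (n * 'C(a.+1, j))); first by ring.
by rewrite -e1; ring.
Qed.

(** The sum [Vs] telescopes, since [8 x] times the [m]-th term of [Ws] is the difference of the
    terms [m + 2] and [m + 1]. *)
Lemma Vs_shift n i :
  (8 * shiftZ (Vs n) i = Ws n.+2 i + Ws n.+1 i - 2 * delta0 i)%BZ.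
Proof.
elim: n i => [|n IHn] i; first by case: i => [|[|i]].
have recW m k : Ws m.+2 k = (Ws m.+1 k + 8 * shiftZ (Ws m) k)%BZ.
  by rewrite /Ws lucas_seq_rec; lia.
have recV m k : Vs m.+1 k = (Vs m k + Ws m.+1 k + Ws m k)%BZ by [].
by have := IHn i; rewrite !recW; case: i => [|i]; cbn [shiftZ];
  rewrite ?recV ?recW; cbn [shiftZ delta0]; lia.
Qed.

Lemma pow2S m : (2 ^ Z.of_nat m.+1 = 2 * 2 ^ Z.of_nat m)%BZ.
Proof. by rewrite Nat2Z.inj_succ Z.pow_succ_r //; lia. Qed.

Lemma pow8S m : (8 ^ Z.of_nat m.+1 = 8 * 8 ^ Z.of_nat m)%BZ.
Proof. by rewrite Nat2Z.inj_succ Z.pow_succ_r //; lia. Qed.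

(** With [L_n(x)] the polynomial of coefficients [lucas n j], the right side comes from
    [2^n L_n(2 x)], which obeys the recurrence of [Qs]. *)
Lemma Qs_lucas n j : (2 * (Qs n.+1 j - Qs n j)
  = 2 ^ Z.of_nat (n + j) * Z.of_nat (lucas n j))%BZ.
Proof.
elim/ltn_ind: n j => -[|[|n]] IHn j;
  try by case: j => [//|j]; rewrite lucas_small ?Z.mul_0_r //; lia.
have recQ m k : Qs m.+2 k = (2 * Qs m.+1 k + 8 * shiftZ (Qs m) k)%BZ by [].
have h1 := IHn n.+1 (ltnSn _) j.
case: j h1 => [|j] h1.
  move: h1; rewrite lucas_rec !addn0 (pow2S n.+1) !recQ; cbn [shiftZ]; nia.
have h0 := IHn n (ltnW (ltnSn _)) j.
rewrite lucas_rec !recQ; cbn [shiftZ].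
have e : (2 ^ Z.of_nat (n.+2 + j.+1) = 4 * 2 * 2 ^ Z.of_nat (n + j))%BZ.
  by rewrite addnS !addSn !pow2S; lia.
have e' : (2 ^ Z.of_nat (n.+1 + j.+1) = 4 * 2 ^ Z.of_nat (n + j))%BZ.
  by rewrite addnS !addSn !pow2S; lia.
by move: h1; rewrite e e' Nat2Z.inj_add !recQ; cbn [shiftZ]; nia.
Qed.

(** Likewise [L_n(8 x)] obeys the recurrence of [Ws]. *)
Lemma Ws_lucas n j : (2 * Ws n.+1 j - Ws n j
  = 8 ^ Z.of_nat j * Z.of_nat (lucas n j))%BZ.
Proof.
elim/ltn_ind: n j => -[|[|n]] IHn j;
  try by case: j => [//|j]; rewrite lucas_small ?Z.mul_0_r //; lia.
have recW m k : Ws m.+2 k = (Ws m.+1 k + 8 * shiftZ (Ws m) k)%BZ.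
  by rewrite /Ws lucas_seq_rec; lia.
have h1 := IHn n.+1 (ltnSn _) j.
case: j h1 => [|j] h1.
  by rewrite lucas_rec addn0; move: h1; rewrite !recW; cbn [shiftZ]; lia.
have h0 := IHn n (ltnW (ltnSn _)) j.
rewrite lucas_rec Nat2Z.inj_add; move: h1; rewrite !recW pow8S; cbn [shiftZ]; nia.
Qed.

(** One step leads from class 8 to classes 1 and 11, whose closed forms are known; [Vs_shift]
    eliminates [Vs]. *)
Lemma g5_formula n i : (Z.of_nat (g5 n.+1 i) =
   shiftZ (fun j => 2 ^ Z.of_nat (n.+1 + j) * Z.of_nat (lucas n.+1 j)) i
   + (8 ^ Z.of_nat i * Z.of_nat (lucas n.+1 i) - delta0 i)
   - shiftZ (fun j => 8 ^ Z.of_nat j * Z.of_nat (lucas n.+1 j) - delta0 j) i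
   + 2 * Es n i)%BZ.
Proof.
rewrite g5_class_count -/(class_countZ 8 n.+1 i).
have [[_ _ _ _] [_ [-> _ _ _ _]]] := class_countZ_recs n i.
have [IH _] := closed_forms_all n.
have e1 j : _ := let: And4 _ _ _ (And3 h _ _) := IH j in h.
have e11 j : _ := let: And4 _ _ _ (And3 _ _ h) := IH j in h.
rewrite e11; cbv zeta in e1.
have hV := Vs_shift n.
have recQ m k : Qs m.+2 k = (2 * Qs m.+1 k + 8 * shiftZ (Qs m) k)%BZ by [].
have recW m k : Ws m.+2 k = (Ws m.+1 k + 8 * shiftZ (Ws m) k)%BZ.
  by rewrite /Ws lucas_seq_rec; lia.
case: i => [|[|i]]; cbn [shiftZ]; rewrite ?e1;
  rewrite -?Qs_lucas -?Ws_lucas ?recQ ?recW; cbn [shiftZ].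
- by have := hV 0; rewrite !recW; cbn [shiftZ delta0]; lia.
- have := hV 0; have := hV 1; cbn [shiftZ]; rewrite !recW; cbn [shiftZ delta0]; lia.
- have := hV i.+2; have := hV i.+1; cbn [shiftZ]; rewrite !recW; cbn [shiftZ delta0]; lia.
Qed.

(** * Unimodality *)

Lemma Es_rec m i : (Es m.+2 i = 4 * shiftZ (Es m) i)%BZ.
Proof. by rewrite /Es lucas_seq_rec; lia. Qed.

Lemma Es0 i : Es 0 i = delta0 i. Proof. by []. Qed.

Lemma Es1 i : Es 1 i = (delta0 i - 3 * shiftZ delta0 i)%BZ. Proof. by []. Qed.

(** [Es m] is [4^k x^k] for [m = 2 k] and [4^k x^k (1 - 3 x)] for [m = 2 k + 1], whence its size,
    sign and support. *)
Lemma Es_le m i : (Es m i <= 4 ^ Z.of_nat i)%BZ.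
Proof.
have p4 j : (0 < 4 ^ Z.of_nat j)%BZ by apply: Z.pow_pos_nonneg; lia.
elim/ltn_ind: m i => -[|[|m]] IHm i.
- by rewrite Es0; case: i => [//|i]; have := p4 i.+1; cbn [delta0]; lia.
- rewrite Es1; case: i => [//|i]; have := p4 i.+1.
  by case: i => [|i]; cbn [delta0 shiftZ]; lia.
rewrite Es_rec; case: i => [//|i]; cbn [shiftZ].
rewrite Nat2Z.inj_succ Z.pow_succ_r; last lia.
by have := IHm m (ltnW (ltnSn _)) i; lia.
Qed.

Lemma Es_ge0 m i : 2 * i <= m -> (0 <= Es m i)%BZ.
Proof.
elim/ltn_ind: m i => -[|[|m]] IHm [|i] h; try lia; try done.
by have := IHm m (ltnW (ltnSn _)) i; rewrite Es_rec; cbn [shiftZ]; lia.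
Qed.

Lemma Es_eq0 m i : (2 * i + 1 < m) || (m + 1 < 2 * i) -> Es m i = 0%BZ.
Proof.
elim/ltn_ind: m i => -[|[|m]] IHm i h.
- by rewrite Es0; case: i h.
- by rewrite Es1; case: i h => [|[|i]].
rewrite Es_rec; case: i h => [//|i] h; cbn [shiftZ].
by rewrite (IHm m) //; lia.
Qed.

Lemma lucas_gt0 n j : 0 < n -> 2 * j <= n -> 0 < lucas n j.
Proof.
move=> n0 h; have := lucas_binM h n0.
have : 0 < n * 'C(n - j, j) by rewrite muln_gt0 n0 bin_gt0; lia.
by case: (lucas n j) => // + e; rewrite -e muln0.
Qed.

Lemma g5S m j : (Z.of_nat (g5 m.+1 j.+1) =
   2 ^ Z.of_nat (m.+1 + j) * Z.of_nat (lucas m.+1 j)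
   + 8 * 8 ^ Z.of_nat j * Z.of_nat (lucas m.+1 j.+1)
   - (8 ^ Z.of_nat j * Z.of_nat (lucas m.+1 j) - delta0 j)
   + 2 * Es m j.+1)%BZ.
Proof. by rewrite g5_formula pow8S; cbn [shiftZ]; rewrite [delta0 j.+1]/=; lia. Qed.

(** At [m + 1 = 2 j] the terms in [2^(3 j)] and [8^j] cancel; beyond, every term vanishes. *)
Lemma g5_eq0 m j : m.+1 <= 2 * j -> g5 m.+1 j.+1 = 0.
Proof.
move=> h; apply: Nat2Z.inj; rewrite g5S Es_eq0; last lia.
rewrite (lucas_small (j := j.+1)); last lia.
rewrite [delta0 j](_ : _ = 0%BZ); last by case: j h.
have [e|ne] := eqVneq m.+1 (2 * j); last by rewrite lucas_small; lia.
rewrite e (_ : Z.of_nat (2 * j + j) = 3 * Z.of_nat j)%BZ; last lia.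
rewrite Z.pow_mul_r; [|lia|lia].
by change (2 ^ 3)%BZ with 8%BZ; lia.
Qed.

(** * Increase before the peak *)

Section Ratio.

Local Open Scope Z_scope.

(** Here [x / y = b / a], so a bound on [b / a] transfers to [x / y]. *)
Lemma ratio_lt (a b x y p q : Z) :
  a * x = b * y -> 0 < a -> 0 < y -> q * a < p * b -> q * y < p * x.
Proof.
move=> e a0 y0 h; apply: (Zmult_lt_reg_r _ _ a a0).
have -> : p * x * a = p * (a * x) by lia.
by rewrite e; have := Zmult_lt_compat_r _ _ y y0 h; lia.
Qed.

Lemma ratio_le (a b x y p q : Z) :
  a * x = b * y -> 0 < a -> 0 <= y -> q * a <= p * b -> q * y <= p * x.
Proof.
move=> e a0 y0 h; apply: (Zmult_le_reg_r _ _ a); first by lia.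
have -> : p * x * a = p * (a * x) by lia.
by rewrite e; have := Zmult_le_compat_r _ _ y h y0; lia.
Qed.

Lemma ratio_ge (a b x y p q : Z) :
  a * x = b * y -> 0 < a -> 0 <= y -> p * b <= q * a -> p * x <= q * y.
Proof.
move=> e a0 y0 h; apply: (Zmult_le_reg_r _ _ a); first by lia.
have -> : p * x * a = p * (a * x) by lia.
by rewrite e; have := Zmult_le_compat_r _ _ y h y0; lia.
Qed.

Lemma lucas_ratioZ n j : (2 * j < n)%N ->
  (Z.of_nat j + 1) * (Z.of_nat n - Z.of_nat j - 1) * Z.of_nat (lucas n j.+1)
  = (Z.of_nat n - 2 * Z.of_nat j) * (Z.of_nat n - 2 * Z.of_nat j - 1)
     * Z.of_nat (lucas n j).
Proof. by move=> h; have := lucas_ratio h; nia. Qed.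

(** This gives [l2 / l1 >= 1 / 4] in [incr_step], where [N = 3 J + 2 + s]. *)
Lemma left_quadratic J s : 0 <= J -> 0 <= s -> 15 <= 3 * J + s ->
  (J + 2) * (2 * J + s) <= 4 * ((J + s) * (J + s - 1)).
Proof.
move=> J0 s0 h.
have : 0 <= 2 * J * (J - 4) + s * (7 * J - 6) + 4 * s * s; last by lia.
have [J4|J4] : 4 <= J \/ J <= 3 by lia.
  by have := Z.mul_nonneg_nonneg (2 * J) (J - 4); nia.
have s6 : 6 <= s by lia.
have : 0 <= s * (7 * J) by apply: Z.mul_nonneg_nonneg; lia.
have : 6 * 18 <= s * (4 * s - 6) by apply: Z.mul_le_mono_nonneg; lia.
have : J * J >= 0 by nia.
nia.
Qed.

(** Here [N], [J], [B], [P], [i] stand for [n], [j], [2^(n+j)], [8^j], [delta0 j], and [l0], [l1],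
    [l2] for consecutive [lucas] numbers. The sign of [2 l1 - l0] decides, unless it is zero. *)
Lemma incr_step N J l0 l1 l2 B P i :
    17 <= N -> 0 <= J -> 3 * J + 1 <= N -> 0 < l0 -> 0 < l1 ->
    (J + 1) * (N - J - 1) * l1 = (N - 2 * J) * (N - 2 * J - 1) * l0 ->
    (J + 2) * (N - J - 2) * l2 = (N - 2 * J - 2) * (N - 2 * J - 3) * l1 ->
    0 < B -> 0 < P -> i <= 1 ->
  B * l0 + 8 * P * l1 - (P * l0 - i) < 2 * B * l1 + 8 * (8 * P) * l2 - 8 * P * l1.
Proof.
move=> hN J0 hJ L0 L1 r0 r1 B0 P0 i1.
have [e|[s [es s0]]] : N = 3 * J + 1 \/ exists s, N = 3 * J + 2 + s /\ 0 <= s.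
- by have [e|ne] : N = 3 * J + 1 \/ 3 * J + 2 <= N; 
    [lia | left | right; exists (N - 3 * J - 2); lia].
(* The terms in [B] cancel, and those in [P] require [14 l1 < 64 l2]. The quadratic polynomial
   behind this is positive at [J = 6] but negative at [J = 5], that is [N = 16]. *)
- have J6 : 6 <= J by lia.
  have e1 : 2 * l1 = l0.
    have : (J + 1) * J * (2 * l1) = (J + 1) * J * l0 by move: r0; rewrite e; lia.
    have JJ : 0 < (J + 1) * J by apply: Z.mul_pos_pos; lia.
    by apply: (proj1 (Z.mul_cancel_l _ _ ((J + 1) * J) _)); lia.
  have e2 : 14 * l1 < 64 * l2.
    apply: (ratio_lt r1); [by apply: Z.mul_pos_pos; lia | lia |].
    rewrite e; have : 0 < (J - 6) * (36 * J - 18) + 48; last by lia.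
    by have := Z.mul_nonneg_nonneg (J - 6) (36 * J - 18); lia.
  have : 0 < P * (64 * l2 - 14 * l1) by apply: Z.mul_pos_pos; lia.
  have : B * (2 * l1 - l0) = 0 by rewrite e1; lia.
  have : P * (2 * l1 - l0) = 0 by rewrite e1; lia.
  lia.
have e1 : 1 * l0 < 2 * l1.
  apply: (ratio_lt r0); [by apply: Z.mul_pos_pos; lia | lia |].
  have : 0 < (N - 3 * J - 1) * (2 * N - 3 * J - 1); last by lia.
  by apply: Z.mul_pos_pos; lia.
have e2 : 1 * l1 <= 4 * l2.
  apply: (ratio_le r1); [by apply: Z.mul_pos_pos; lia | lia |].
  by have := left_quadratic J0 s0; rewrite es; lia.
have : 1 * 1 <= B * (2 * l1 - l0) by apply: Z.mul_le_mono_nonneg; lia.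
have : 0 < P * l0 by apply: Z.mul_pos_pos.
have : 0 <= P * (64 * l2 - 16 * l1) by apply: Z.mul_nonneg_nonneg; lia.
lia.
Qed.

End Ratio.

(** In this range both indices lie below the support of [Es], so [incr_step] applies directly. *)
Lemma g5_lt_left m j : 17 <= m.+1 -> 3 * j + 1 <= m.+1 -> g5 m.+1 j.+1 < g5 m.+1 j.+2.
Proof.
move=> h17 hj.
have : (Z.of_nat (g5 m.+1 j.+1) < Z.of_nat (g5 m.+1 j.+2))%BZ; last by lia.
rewrite !g5S !Es_eq0; try lia.
have L0 : (0 < Z.of_nat (lucas m.+1 j))%BZ.
  by have := @lucas_gt0 m.+1 j; lia.
have L1 : (0 < Z.of_nat (lucas m.+1 j.+1))%BZ.
  by have := @lucas_gt0 m.+1 j.+1; lia.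
have r0 := @lucas_ratioZ m.+1 j; have r1 := @lucas_ratioZ m.+1 j.+1.
have B0 : (0 < 2 ^ Z.of_nat (m.+1 + j))%BZ by apply: Z.pow_pos_nonneg; lia.
have P0 : (0 < 8 ^ Z.of_nat j)%BZ by apply: Z.pow_pos_nonneg; lia.
rewrite addnS pow2S pow8S [delta0 j.+1]/=.
have i0 : (delta0 j <= 1)%BZ by case: (j).
have {}r0 := r0 ltac:(lia); have {}r1 := r1 ltac:(lia).
have := @incr_step (Z.of_nat m.+1) (Z.of_nat j) _ _ (Z.of_nat (lucas m.+1 j.+2))
  _ _ (delta0 j) _ _ _ L0 L1 r0 _ B0 P0 i0.
by lia.
Qed.

(** * Decrease after the peak *)

Section Decr.

Local Open Scope Z_scope.

Lemma pow2_lower d : 6 <= d -> 9 * d + 10 <= 2 ^ d.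
Proof.
move=> d6; have -> : d = 6 + Z.of_nat (Z.to_nat (d - 6)) by lia.
elim: (Z.to_nat _) => [//|k IHk].
by rewrite Nat2Z.inj_succ Z.add_succ_r Z.pow_succ_r; lia.
Qed.

(** With [d = n - 2 j], one has [2^(n+j) = 8^j 2^d]; the expression is the main part of the
    difference of two consecutive values, divided by [8^j]. *)
Lemma decr_step J d l0 l1 l2 :
    3 <= d -> d <= J -> 17 <= 2 * J + d -> 0 < l0 -> 0 <= l1 ->
    (J + 1) * (J + d - 1) * l1 = d * (d - 1) * l0 ->
    (J + 2) * (J + d - 2) * l2 = (d - 2) * (d - 3) * l1 ->
  0 < 2 ^ d * (l0 - 2 * l1) - 64 * l2 + 16 * l1 - l0.
Proof.
move=> d3 dJ hn L0 L1 r0 r1.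
have a0 : 0 < (J + 1) * (J + d - 1) by apply: Z.mul_pos_pos; lia.
have a1 : 0 < (J + 2) * (J + d - 2) by apply: Z.mul_pos_pos; lia.
have [e|[e|d5]] : d = 3 \/ d = 4 \/ 5 <= d by lia.
- have l2_0 : 1 * l2 <= 0 * l1 by apply: (ratio_ge r1); [lia|lia|rewrite e; lia].
  rewrite e; change (2 ^ 3) with 8.
  have : 4 * l1 <= 1 * l0 by apply: (ratio_ge r0); [lia|lia|rewrite e; nia].
  lia.
- have h : 5 * l1 <= 1 * l0 by apply: (ratio_ge r0); [lia|lia|rewrite e; nia].
  have : 2 * l2 <= 1 * l1 by apply: (ratio_ge r1); [lia|lia|rewrite e; nia].
  by rewrite e; change (2 ^ 4) with 16; lia.
have l21 : 2 * l2 <= 1 * l1.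
  apply: (ratio_ge r1); [lia|lia|].
  have : (d - 2) * (2 * (d - 3)) <= (J + 2) * (J + d - 2).
    by apply: Z.mul_le_mono_nonneg; lia.
  lia.
have l10 : (2 * (J + 1)) * l1 <= d * l0.
  apply: (ratio_ge r0); [lia|lia|].
  have : (d * (J + 1)) * (2 * (d - 1)) <= (d * (J + 1)) * (J + d - 1).
    by apply: Z.mul_le_mono_nonneg_l; [apply: Z.mul_nonneg_nonneg|]; lia.
  lia.
(* As [2 l2 <= l1] and [2 l1 <= l0], the terms without [2^d] are at least [- 9 l0]. The case [d = 5]
   is too small for [pow2_lower], but there [J >= 6]. *)
have T9 : 9 * (J + 1) < 2 ^ d * (J + 1 - d).
  have [e|d6] : d = 5 \/ 6 <= d by lia.
    by rewrite e; change (2 ^ 5) with 32; lia.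
  have h := pow2_lower d6.
  have : (9 * d + 10) * (J + 1 - d) <= 2 ^ d * (J + 1 - d).
    by apply: Z.mul_le_mono_nonneg_r; lia.
  have : 9 * (J + 1) < (9 * d + 10) * (J + 1 - d); last by lia.
  have : 0 <= (9 * d + 1) * (J - d) by apply: Z.mul_nonneg_nonneg; lia.
  lia.
have T0 : 0 < 2 ^ d by apply: Z.pow_pos_nonneg; lia.
have key : 9 * l0 < 2 ^ d * (l0 - 2 * l1).
  apply: (Zmult_lt_reg_r _ _ (J + 1)); first by lia.
  have : 9 * (J + 1) * l0 < 2 ^ d * (J + 1 - d) * l0 by apply: Zmult_lt_compat_r.
  have : 2 ^ d * (2 * (J + 1) * l1) <= 2 ^ d * (d * l0).
    by apply: Z.mul_le_mono_nonneg_l; lia.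
  lia.
have : 2 * l1 <= 1 * l0; last by lia.
apply: (ratio_ge r0); [lia|lia|].
have : d * (2 * (d - 1)) <= (J + 1) * (J + d - 1).
  by apply: Z.mul_le_mono_nonneg; lia.
lia.
Qed.

End Decr.

Lemma g5_lt_right m j : 17 <= m.+1 -> m.+1 <= 3 * j -> 2 * j + 3 <= m.+1 ->
  g5 m.+1 j.+2 < g5 m.+1 j.+1.
Proof.
move=> h17 hj hd.
have : (Z.of_nat (g5 m.+1 j.+2) < Z.of_nat (g5 m.+1 j.+1))%BZ; last by lia.
rewrite !g5S.
have L0 : (0 < Z.of_nat (lucas m.+1 j))%BZ.
  by have := @lucas_gt0 m.+1 j; lia.
have L1 : (0 <= Z.of_nat (lucas m.+1 j.+1))%BZ by lia.
have {}r0 := @lucas_ratioZ m.+1 j ltac:(lia).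
have {}r1 := @lucas_ratioZ m.+1 j.+1 ltac:(lia).
have E1 := @Es_le m j.+2.
have E0 : (0 <= Es m j.+1)%BZ by apply: Es_ge0; lia.
pose d := (Z.of_nat m.+1 - 2 * Z.of_nat j)%BZ.
have X := @decr_step (Z.of_nat j) d _ _ (Z.of_nat (lucas m.+1 j.+2))
  ltac:(lia) ltac:(lia) ltac:(lia) L0 L1 ltac:(lia) ltac:(lia).
have p4 : (4 ^ Z.of_nat j.+2 = 16 * 4 ^ Z.of_nat j)%BZ.
  by rewrite (_ : Z.of_nat j.+2 = 2 + Z.of_nat j)%BZ ?Z.pow_add_r //; lia.
have p8 : (8 ^ Z.of_nat j = 2 ^ Z.of_nat j * 4 ^ Z.of_nat j)%BZ.
  by rewrite -Z.pow_mul_l.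
have p2 : (64 <= 2 ^ Z.of_nat j)%BZ.
  by rewrite -[64%BZ]/(2 ^ 6)%BZ; apply: Z.pow_le_mono_r; lia.
have p40 : (0 < 4 ^ Z.of_nat j)%BZ by apply: Z.pow_pos_nonneg; lia.
have pB : (2 ^ Z.of_nat (m.+1 + j) = 8 ^ Z.of_nat j * 2 ^ d)%BZ.
  rewrite (_ : Z.of_nat (m.+1 + j) = 3 * Z.of_nat j + d)%BZ; last by lia.
  by rewrite Z.pow_add_r; [rewrite Z.pow_mul_r; [|lia|lia]|lia|lia].
have i0 : delta0 j = 0%BZ by case: j hj {L0 L1 r0 r1 E1 E0 d X p4 p8 p2 p40 pB hd}.
rewrite addnS pow2S pow8S [delta0 j.+1]/= i0 pB.
rewrite p4 in E1.
(* A positive integer is at least 1, so the main part is at least [8^j >= 64 * 4^j], which outweighs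
   the [Es] term, at most [2 * 16 * 4^j]. *)
have : (8 ^ Z.of_nat j * 1 <= 8 ^ Z.of_nat j * (2 ^ d * (Z.of_nat (lucas m.+1 j)
    - 2 * Z.of_nat (lucas m.+1 j.+1)) - 64 * Z.of_nat (lucas m.+1 j.+2)
    + 16 * Z.of_nat (lucas m.+1 j.+1) - Z.of_nat (lucas m.+1 j)))%BZ.
  by apply: Z.mul_le_mono_nonneg_l; [rewrite p8; apply: Z.mul_nonneg_nonneg|]; lia.
have : (64 * 4 ^ Z.of_nat j <= 8 ^ Z.of_nat j)%BZ.
  by rewrite p8; apply: Z.mul_le_mono_nonneg_r; lia.
by lia.
Qed.

(** * Small lengths and conclusion *)

Definition g5Z m i : Z :=
  (shiftZ (fun j => 2 ^ Z.of_nat (m.+1 + j) * Z.of_nat (lucas m.+1 j)) i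
   + (8 ^ Z.of_nat i * Z.of_nat (lucas m.+1 i) - delta0 i)
   - shiftZ (fun j => 8 ^ Z.of_nat j * Z.of_nat (lucas m.+1 j) - delta0 j) i
   + 2 * Es m i)%BZ.

(** The lengths 2 to 16 are checked by evaluating the formula for [g5]; for larger [i], [g5_eq0]
    applies. *)
Lemma g5Z_small : all (fun m => all (fun i =>
    if i < p5 m.+1 then Z.ltb (g5Z m i) (g5Z m i.+1)
    else if i == p5 m.+1 then Z.ltb (g5Z m i.+1) (g5Z m i)
    else Z.leb (g5Z m i.+1) (g5Z m i)) (iota 0 m.+3)) (iota 1 15).
Proof. by vm_compute. Qed.

Lemma g5_lt_01 m : 17 <= m.+1 -> g5 m.+1 0 < g5 m.+1 1.
Proof.
move=> h17; have : (Z.of_nat (g5 m.+1 0) < Z.of_nat (g5 m.+1 1))%BZ; last by lia.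
rewrite g5S g5_formula !Es_eq0; try lia.
rewrite lucas0 // addn0; cbn [shiftZ delta0].
have : (0 < 2 ^ Z.of_nat m.+1)%BZ by apply: Z.pow_pos_nonneg; lia.
by rewrite -[(8 ^ Z.of_nat 0)%BZ]/1%BZ; lia.
Qed.

(** The value at [p] is positive, so [p] is an attained genus and lies between the minimum and the
    maximum. *)
Lemma g5_peak n p :
    (forall i, i < p -> g5 n i < g5 n i.+1) -> g5 n p.+1 < g5 n p ->
    (forall i, p < i -> g5 n i.+1 <= g5 n i) ->
  is_peak (@g5 n) (min_genus5 n) (max_genus5 n) p.
Proof.
move=> up top down.
have /card_gt0P[KT] : 0 < g5 n p by exact: leq_ltn_trans top.
rewrite inE => /eqP gp.
have minp : min_genus5 n <= p.
  by rewrite /min_genus5; case: arg_minnP => // KT' _ /(_ KT isT); rewrite gp.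
have maxp : p <= max_genus5 n.
  by rewrite /max_genus5; case: arg_maxnP => // KT' _ /(_ KT isT); rewrite /= gp.
split.
- by rewrite minp leqnn.
- split=> [i _ ip|qp]; first by rewrite ltnW ?up // ltnW.
  have p0 := leq_ltn_trans (leq0n _) qp.
  by have := up p.-1; rewrite prednK // leqnn => /(_ isT).
- by move=> i ip; congr g5; apply/eqP; rewrite eqn_leq andbC.
- by split=> // i ip _; apply: down.
Qed.

Lemma g5_peak_p5 n : 2 <= n ->
  is_peak (@g5 n) (min_genus5 n) (max_genus5 n) (p5 n).
Proof.
case: n => [//|m] m1; have [h16|h17] := leqP m.+1 16.
  have mi : m \in iota 1 15 by rewrite mem_iota; lia.
  have ppos : p5 m.+1 <= m.+1 by rewrite /p5; case: ifP => _; [|case: ifP => _]; lia.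
  have gE i : Z.of_nat (g5 m.+1 i) = g5Z m i by exact: g5_formula.
  apply: g5_peak => [i ip||i ip].
  - have := allP (allP g5Z_small _ mi) i; rewrite mem_iota ip -!gE => h.
    by have := h ltac:(lia); lia.
  - have := allP (allP g5Z_small _ mi) (p5 m.+1); rewrite mem_iota ltnn eqxx -!gE => h.
    by have := h ltac:(lia); lia.
  - have [hi|hi] := ltnP i m.+3; last first.
      by case: i hi {ip} => // i hi; rewrite g5_eq0 //; lia.
    have := allP (allP g5Z_small _ mi) i.
    have nlt : (i < p5 m.+1) = false by lia.
    have neq : (i == p5 m.+1) = false by lia.
    rewrite mem_iota nlt neq -!gE => h.
    by have := h ltac:(lia); lia.
have -> : p5 m.+1 = (m.+1 + 2) %/ 3 + 1 by rewrite /p5 !ifN //; lia.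
apply: g5_peak => [i ip||i ip].
- case: i ip => [|j] jp; last by apply: g5_lt_left; lia.
  exact: g5_lt_01.
- by rewrite addn1; apply: g5_lt_right; lia.
(* Once [2 j + 3] exceeds the length, the next value is already zero. *)
- case: i ip => // j jp; have [h|h] := leqP (2 * j + 3) m.+1.
    by apply: ltnW; apply: g5_lt_right; lia.
  by rewrite g5_eq0 //; lia.
Qed.

Theorem theorem3p16 (n : nat) (hn : 2 <= n) :
  unimodal (@g5 n) (min_genus5 n) (max_genus5 n) /\
  is_peak (@g5 n) (min_genus5 n) (max_genus5 n) (p5 n).
Proof.
by split; [exists (p5 n), (p5 n)|]; apply: g5_peak_p5.
Qed.
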